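(* Perfectly colorable graphs can be recognized and colored in linear time: there is an algorithm which, given a finite simple graph $G$ with $n$ vertices and $m$ edges, runs in time $O(n+m)$, decides whether $G$ is perfectly colorable, and, if it is, outputs a perfect coloring of $G$.
   Context: All graphs are finite and simple, and are given to the algorithm by adjacency lists; running time is measured in the standard unit-cost RAM model. For a graph $H$, $\omega(H)$ denotes its clique number (the maximum size of a set of pairwise adjacent vertices). A perfect coloring of a graph $G$ is a proper vertex coloring of $G$ such that for every (nonempty) connected induced subgraph $H$ of $G$, the number of distinct colors appearing on the vertices of $H$ is exactly $\omega(H)$. A graph is perfectly colorable if it admits a perfect coloring. *)

(* Defs.v *)
From mathcomp Require Import all_boot.
Set Implicit Arguments.
Unset Strict Implicit.
Unset Printing Implicit Defensive.

(** * Perfect colorings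

  A finite simple graph is a symmetric irreflexive adjacency relation on a
  finType. *)

Definition simple_graph (T : finType) (e : rel T) : Prop :=
  symmetric e /\ irreflexive e.

Definition edges (T : finType) (e : rel T) : {set {set T}} :=
  [set [set p.1; p.2] | p : T * T & e p.1 p.2].

Definition clique (T : finType) (e : rel T) (K : {set T}) : bool :=
  [forall x in K, forall y in K, (x != y) ==> e x y].

Definition clique_number (T : finType) (e : rel T) : nat :=
  \max_(K : {set T} | clique e K) #|K|.

Definition connected (T : finType) (e : rel T) : Prop :=
  forall x y : T, connect e x y.

Definition induced (T : finType) (e : rel T) (S : {set T}) :
    rel {x : T | x \in S} :=
  fun x y => e (val x) (val y).

Definition proper_coloring (T : finType) (e : rel T) (col : T -> nat) : Prop :=
  forall x y, e x y -> col x <> col y.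

Definition num_colors (T : finType) (col : T -> nat) : nat :=
  size (undup (codom col)).

Definition perfect_coloring (T : finType) (e : rel T) (col : T -> nat) : Prop :=
  proper_coloring e col /\
  forall S : {set T}, S != set0 -> connected (@induced T e S) ->
    num_colors (fun x : {x : T | x \in S} => col (val x)) =
    clique_number (@induced T e S).

Definition perfectly_colorable (T : finType) (e : rel T) : Prop :=
  exists col : T -> nat, perfect_coloring e col.

(** * Unit-cost random access machine

  The machine of Cook and Reckhow: a finite fixed program, registers X_0, X_1,
  ... each holding a natural number of any size and initially 0, indirect
  addressing, a sequential input tape and a sequential output tape.  Every
  instruction costs one unit of time.  Addition and truncated subtraction are
  the only arithmetic operations; there is no unit-cost multiplication. *)

Inductive instr : Type :=
| Const of nat & nat        (* Const i c   : X_i := c *)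
| Add of nat & nat & nat    (* Add i j k   : X_i := X_j + X_k *)
| Sub of nat & nat & nat    (* Sub i j k   : X_i := X_j - X_k, truncated at 0 *)
| Fetch of nat & nat        (* Fetch i j   : X_i := X_(X_j) *)
| Store of nat & nat        (* Store i j   : X_(X_i) := X_j *)
| JumpPos of nat & nat      (* JumpPos i l : go to line l if X_i > 0 *)
| Read of nat               (* Read i      : X_i := next input, 0 if none left *)
| Print of nat.             (* Print i     : append X_i to the output *)

Definition program := seq instr.

Record config := Config {
  pc : nat;
  reg : nat -> nat;
  input : seq nat;
  output : seq nat
}.

Definition upd (r : nat -> nat) (i a : nat) : nat -> nat :=
  fun j => if j == i then a else r j.

Definition exec (c : instr) (s : config) : config :=
  let: Config l r inp out := s in
  match c with
  | Const i a => Config l.+1 (upd r i a) inp out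
  | Add i j k => Config l.+1 (upd r i (r j + r k)) inp out
  | Sub i j k => Config l.+1 (upd r i (r j - r k)) inp out
  | Fetch i j => Config l.+1 (upd r i (r (r j))) inp out
  | Store i j => Config l.+1 (upd r (r i) (r j)) inp out
  | JumpPos i l' => Config (if 0 < r i then l' else l.+1) r inp out
  | Read i => Config l.+1 (upd r i (head 0 inp)) (behead inp) out
  | Print i => Config l.+1 r inp (rcons out (r i))
  end.

(* The machine halts when the program counter leaves the program; a halted
   configuration is a fixed point of [step]. *)
Definition step (p : program) (s : config) : config :=
  if onth p (pc s) is Some c then exec c s else s.

Definition halted (p : program) (s : config) : bool := size p <= pc s.

Definition init (inp : seq nat) : config := Config 0 (fun _ => 0) inp [::].

Definition halts_within (p : program) (inp : seq nat) (t : nat)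
    (out : seq nat) : Prop :=
  exists2 t', t' <= t &
    let s := iter t' (step p) (init inp) in halted p s /\ output s = out.

(** * Input and output formats *)

(* Each list enumerates the neighbors of a vertex once, in any order. *)
Definition adjacency_lists (n : nat) (e : rel 'I_n)
    (adj : 'I_n -> seq 'I_n) : Prop :=
  forall v, uniq (adj v) /\ (forall w, (w \in adj v) = e v w).

(* n, then for v = 0, ..., n-1 the degree of v followed by its neighbors *)
Definition encode_graph (n : nat) (adj : 'I_n -> seq 'I_n) : seq nat :=
  n :: flatten [seq size (adj v) :: [seq val w | w <- adj v] | v <- enum 'I_n].

(* 0 for rejection; 1, then the colors of vertices 0, ..., n-1 otherwise *)
Definition encode_reject : seq nat := [:: 0].

Definition encode_coloring (n : nat) (col : 'I_n -> nat) : seq nat :=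
  1 :: [seq col v | v <- enum 'I_n].

Definition correct_answer (n : nat) (e : rel 'I_n) (out : seq nat) : Prop :=
  (perfectly_colorable e ->
     exists2 col : 'I_n -> nat,
       perfect_coloring e col & out = encode_coloring col) /\
  (~ perfectly_colorable e -> out = encode_reject).

(* Main.v *)
Require Import Defs.
From mathcomp Require Import all_boot.
From mathcomp Require Import zify.
Set Implicit Arguments.
Unset Strict Implicit.
Unset Printing Implicit Defensive.

(** A proper coloring is perfect iff every walk x, y, z has x adjacent to z or
  col x = col z.  Hence in a connected subgraph every vertex sees every color
  other than its own, and coloring the vertices in breadth-first order, each
  with the least color not used by its neighbors, reproduces any perfect
  coloring up to a renaming of the colors of each component.  Whether the
  greedy coloring is perfect is then decided component by component: either it
  uses at most two colors, or every vertex must be adjacent to all vertices of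
  the other colors, which is checked by comparing its degree with the size of
  its component minus the size of its color class. *)

(** * Perfect colorings are local *)

(** A proper coloring with at most two colors is always locally perfect, since the ends of a walk x,
    y, z both avoid the color of y. Once three colors occur, any two of them are avoided by a third,
    and a neighbor of that third color is the bridge which shows that the component is complete
    multipartite. This replaces the condition on walks, of which there are too many to inspect in
    linear time, by one comparison per vertex. Breadth-first order matters only because every vertex
    but the first of its component has an earlier neighbor. All prefixes of the order are then
    connected, so the comparison with an arbitrary perfect coloring can proceed vertex by vertex.
    The time bound is proved for a small structured language with arrays and a clock in its state,
    then carried over to the machine at the cost of a constant factor. The machine cannot multiply,
    so array cells are interleaved with a power of two as stride and addressed by doublings. *)

Definition locally_perfect (T : finType) (e : rel T) (col : T -> nat) : Prop :=
  forall x y z, e x y -> e y z -> e x z \/ col x = col z.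

(** A maximum clique [K] shows all the colors. Any vertex of [K] sees every color in its closed
    neighborhood; if a color were absent from [K], a vertex [x] carrying it and adjacent to one
    member of [K] would, by local perfection, be adjacent to all of them and enlarge [K]. *)
Lemma connected_num_colors (T : finType) (e : rel T) (col : T -> nat) (t : T) :
  symmetric e -> connected e -> proper_coloring e col -> locally_perfect e col ->
  num_colors col = clique_number e.
Proof.
move=> sym_e conn prop loc; apply/eqP; rewrite eqn_leq; apply/andP; split; last first.
  apply/bigmax_leqP => K /forall_inP cK.
  rewrite cardE -(size_map col); apply: uniq_leq_size.
    rewrite map_inj_in_uniq ?enum_uniq // => x y; rewrite !mem_enum => Kx Ky Exy.
    apply: contra_eq Exy => neq; apply/eqP/prop.
    by have /forall_inP/(_ y Ky)/implyP/(_ neq) := cK x Kx.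
  by move=> _ /mapP[x _ ->]; rewrite mem_undup codom_f.
have c1 : clique e [set t].
  by apply/forall_inP=> x /set1P->; apply/forall_inP=> y /set1P->; rewrite eqxx.
have [K cK maxK] : {K | clique e K & clique_number e = #|K|}.
  exact: (@eq_bigmax_cond _ [pred K | clique e K] (fun K : {set T} => #|K|)
            (ltac:(by apply/card_gt0P; exists [set t]))).
rewrite maxK cardE -(size_map col) uniq_leq_size ?undup_uniq // => a.
rewrite mem_undup => /codomP[y ->].
have [w Kw] : exists w, w \in K.
  apply/card_gt0P; rewrite -maxK; apply: leq_trans (leq_bigmax_cond _ c1).
  by rewrite cards1.
(* Induction on a path from [w]: if [v] sees the color at [x], the walk w, v, x shows that [w] sees
   it at [x] or carries it itself. *)
have [x xw <-] : exists2 x, (x = w) \/ e w x & col x = col y.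
  have /connectP[p] := conn w y; elim: p w {Kw} => /= [|v p IH] w.
    by move=> _ ->; exists w => //; left.
  move=> /andP[wv pv] Ey; have [x [->|vx] <-] := IH v pv Ey.
    by exists v => //; right.
  have [ewx|Ewx] := loc w v x wv vx; first by exists x => //; right.
  by exists w => //; left.
case: (boolP (col x \in _)) => // Kx.
have nKx z : z \in K -> col z <> col x.
  by move=> Kz Ezx; case/negP: Kx; rewrite -Ezx map_f ?mem_enum.
have eKx z : z \in K -> e z x.
  case: xw => [Exw|ewx] Kz; first by case: (nKx w Kw); rewrite Exw.
  have [-> //|nzw] := eqVneq z w.
  have ezw : e z w.
    by move/forall_inP: cK => /(_ z Kz)/forall_inP/(_ w Kw)/implyP/(_ nzw).
  by have [|/(nKx z Kz)] := loc z w x ezw ewx.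
have cxK : clique e (x |: K).
  apply/forall_inP=> y1 /setU1P[->|K1]; apply/forall_inP=> y2 /setU1P[->|K2];
    apply/implyP=> n12.
  - by rewrite eqxx in n12.
  - by rewrite sym_e eKx.
  - exact: eKx.
  - by move/forall_inP: cK => /(_ _ K1)/forall_inP/(_ _ K2)/implyP/(_ n12).
have nx : x \notin K by apply/negP=> /nKx; apply.
have : #|x |: K| <= clique_number e by apply: leq_bigmax_cond.
by rewrite maxK cardsU1 nx ltnn.
Qed.

(** Local perfection passes to induced subgraphs, which gives one direction. For the other, a
    violating walk x, y, z induces a connected path with three colors whose cliques have at most two
    vertices. *)
Lemma perfect_coloringP (T : finType) (e : rel T) (col : T -> nat) :
  simple_graph e ->
  perfect_coloring e col <-> proper_coloring e col /\ locally_perfect e col.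
Proof.
move=> [sym_e irr_e]; split=> [[prop perf]|[prop loc]]; split=> //; last first.
  move=> S /set0Pn[t St] conn.
  apply: (connected_num_colors (exist _ t St)) => //.
  - by move=> x y; apply: sym_e.
  - by move=> x y; apply: prop.
  - by move=> x y z; apply: loc.
move=> x y z exy eyz; case: (boolP (e x z)) => [|nxz]; first by left.
right; apply/eqP; case: eqP => // Nxz; exfalso.
have Nxy := prop _ _ exy; have Nyz := prop _ _ eyz.
pose S := [set x; y; z].
have Sx : x \in S by rewrite !inE eqxx.
have Sy : y \in S by rewrite !inE eqxx orbT.
have Sz : z \in S by rewrite !inE eqxx !orbT.
pose sx := exist (fun w => w \in S) x Sx; pose sy := exist (fun w => w \in S) y Sy.
pose sz := exist (fun w => w \in S) z Sz.
have allS (w : {x | x \in S}) : [\/ w = sx, w = sy | w = sz].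
  have := valP w; rewrite !inE -!orbA => /or3P[]/eqP E; [apply: Or31|apply: Or32|apply: Or33];
    exact: val_inj.
have ey w : w = sy \/ @induced T e S w sy.
  by have [->|->|->] := allS w; [right|left|right]; rewrite /induced //= sym_e.
have conn : connected (@induced T e S).
  have sym_i : symmetric (@induced T e S) by move=> u v; apply: sym_e.
  move=> u v; apply: (@connect_trans _ _ sy).
    by case: (ey u) => [->|/connect1].
  by case: (ey v) => [->|]; rewrite // sym_i => /connect1.
have S0 : S != set0 by apply/set0Pn; exists x.
have := perf S S0 conn; apply/eqP; rewrite gtn_eqF //.
apply: (@leq_ltn_trans 2); last first.
  apply: (@uniq_leq_size _ [:: col x; col y; col z]).
    by rewrite /= !inE !negb_or; apply/and3P; split=> //; [apply/andP; split|]; apply/eqP.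
  move=> c; rewrite mem_undup !inE => /or3P[]/eqP->.
  - exact: (codom_f (fun w => col (val w)) sx).
  - exact: (codom_f (fun w => col (val w)) sy).
  - exact: (codom_f (fun w => col (val w)) sz).
apply/bigmax_leqP => K /forall_inP cK.
have [u Ku] : exists u, K \subset [set u; sy].
  case: (boolP (sx \in K)) => Kx; [exists sx|exists sz]; apply/subsetP=> w Kw;
    have [E|E|E] := allS w; rewrite {w}E in Kw *; rewrite !inE ?eqxx ?orbT //.
  - have /forall_inP/(_ _ Kw)/implyP := cK _ Kx; rewrite /induced /= (negbTE nxz).
    by case: eqP => [/(congr1 val)/= E|_ /(_ isT)//]; rewrite E in Nxz.
  - by rewrite Kw in Kx.
by apply: leq_trans (subset_leq_card Ku) _; rewrite cards2; case: eqP.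
Qed.

(** * Greedy colorings along a search order *)

Record adjacency (n : nat) (A : nat -> seq nat) : Prop := Adjacency {
  adj_uniq : forall x, uniq (A x);
  adj_sym : forall x y, (x \in A y) = (y \in A x);
  adj_irr : forall x, x \notin A x;
  adj_bound : forall x y, y \in A x -> y < n
}.

(** Unlike [locally_perfect], this includes properness; it is the form in which colorings of the
    machine's numbered vertices are compared. *)
Definition locally_perfect_nat (A : nat -> seq nat) (c : nat -> nat) : Prop :=
  (forall x y, y \in A x -> c y <> c x) /\
  (forall x y z, y \in A x -> z \in A y -> z \in A x \/ c z = c x).

(* [D] lists vertices of one component in search order; [col x] is the least
   color above [b] absent from the earlier neighbors of [x]. *)
Inductive greedy (A : nat -> seq nat) (col : nat -> nat) (b : nat) :
    seq nat -> Prop :=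
| greedy_nil : greedy A col b [::]
| greedy_rcons D x : greedy A col b D -> x \notin D ->
    D = [::] \/ (exists2 y, y \in D & y \in A x) ->
    b < col x -> (forall y, y \in D -> y \in A x -> col y <> col x) ->
    (forall a, b < a < col x -> exists y, [/\ y \in D, y \in A x & col y = a]) ->
    greedy A col b (rcons D x).

Lemma greedy_ext A col col' b D :
  {in D, col =1 col'} -> greedy A col b D -> greedy A col' b D.
Proof.
move=> E H; elim: H E => {D} [|D x _ IH Dx par bx prop mex] E; first exact: greedy_nil.
have ED : {in D, col =1 col'} by move=> y Dy; rewrite E // mem_rcons inE Dy orbT.
have Ex : col x = col' x by rewrite E // mem_rcons mem_head.
apply: greedy_rcons; rewrite -?Ex //; first exact: IH.
  by move=> y Dy; rewrite -ED //; apply: prop.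
by move=> a /mex[y [Dy yx <-]]; exists y; split=> //; rewrite ED.
Qed.

Lemma greedy_uniq A col b D : greedy A col b D -> uniq D.
Proof. by elim=> // {}D x _ IH Dx _ _ _ _; rewrite rcons_uniq Dx. Qed.

Lemma greedy_gt A col b D x : greedy A col b D -> x \in D -> b < col x.
Proof.
by elim=> // {}D y _ IH _ _ by_ _ _; rewrite mem_rcons inE => /orP[/eqP->|/IH].
Qed.

Lemma greedy_proper n A col b D x y : adjacency n A -> greedy A col b D ->
  x \in D -> y \in D -> y \in A x -> col y <> col x.
Proof.
move=> HA; elim=> // {}D v _ IH Dv _ _ prop _.
rewrite !mem_rcons !inE => /orP[/eqP->|Dx] /orP[/eqP->|Dy]; last exact: IH.
- by rewrite (negbTE (adj_irr HA _)).
- exact: prop.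
- by rewrite (adj_sym HA) => H /esym; apply: prop.
Qed.

Lemma greedy_mex A col b D x a : greedy A col b D -> x \in D -> b < a < col x ->
  exists y, [/\ y \in D, y \in A x & col y = a].
Proof.
elim=> // {}D v _ IH Dv _ _ _ mex Dx lt_a.
suff [y [Dy yx Ey]] : exists y, [/\ y \in D, y \in A x & col y = a].
  by exists y; split=> //; rewrite mem_rcons inE Dy orbT.
move: Dx; rewrite mem_rcons inE => /orP[/eqP Ex|/IH]; last exact.
by rewrite Ex in lt_a *; apply: mex.
Qed.

Lemma greedy_attained A col b D x a : greedy A col b D -> x \in D ->
  b < a <= col x -> exists2 y, y \in D & col y = a.
Proof.
move=> gD Dx /andP[lt_ba]; rewrite leq_eqVlt => /orP[/eqP->|lt_a]; first by exists x.
have [|y [Dy _ Ey]] := greedy_mex (a := a) gD Dx; last by exists y.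
by rewrite lt_ba.
Qed.

(** Connectedness of [D] in the form of an induction principle: the last vertex exchanges [P] with
    the others through its earlier neighbor. *)
Lemma greedy_propagate n A col b D (P : nat -> Prop) : adjacency n A ->
  greedy A col b D ->
  (forall x y, x \in D -> y \in D -> y \in A x -> P x -> P y) ->
  forall x y, x \in D -> y \in D -> P x -> P y.
Proof.
move=> HA; elim=> // {}D v _ IH Dv par _ _ _ step.
have inD u : u \in D -> u \in rcons D v by rewrite mem_rcons inE => ->; rewrite orbT.
have inv : v \in rcons D v by rewrite mem_rcons mem_head.
have {}IH : forall x y, x \in D -> y \in D -> P x -> P y.
  by apply: IH => x y Dx Dy; apply: step; apply: inD.
move=> x y; rewrite !mem_rcons !inE.
case: par => [-> /=|[u Du uv]]; first by rewrite !orbF => /eqP-> /eqP->.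
have Puv : P u -> P v by apply: step (inD _ Du) inv _; rewrite (adj_sym HA).
have Pvu : P v -> P u by apply: step inv (inD _ Du) uv.
move=> /orP[/eqP->|Dx] /orP[/eqP->|Dy] // Px.
- by apply: (IH u y) => //; apply: Pvu.
- by apply: Puv; apply: (IH x u).
- exact: (IH x y).
Qed.

(** The argument about closed neighborhoods again, now with all witnesses inside the prefix [D], as
    the comparison of colorings requires. *)
Lemma greedy_sees n A col b D c x y : adjacency n A -> locally_perfect_nat A c ->
  greedy A col b D -> x \in D -> y \in D ->
  exists z, [/\ z \in D, z = x \/ z \in A x & c z = c y].
Proof.
move=> HA [prop loc] gD Dx Dy.
pose P u := exists z, [/\ z \in D, z = u \/ z \in A u & c z = c y].
apply: (greedy_propagate (P := P) HA gD _ Dy Dx); last by exists y; split=> //; left.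
move=> u v Du Dv uv [z [Dz zu Ez]].
have vu : u \in A v by rewrite (adj_sym HA).
case: zu => [Ezu|zu]; first by exists u; split; [|right|rewrite -Ezu].
have [zv|Ezv] := loc v u z vu zu; first by exists z; split=> //; right.
by exists v; split=> //; [left|rewrite -Ezv].
Qed.

(** When [v] is added, its neighbors in [D] show every [c]-color of [D] other than that of [v], and
    none equal to it. By induction [col] renames [c] on [D], so the least color free at [v] is that
    of the class of [c v] if this class meets [D], and new otherwise. *)
Lemma greedy_agrees n A col b D c x y : adjacency n A -> locally_perfect_nat A c ->
  greedy A col b D -> x \in D -> y \in D -> (col x == col y) = (c x == c y).
Proof.
move=> HA Hc gD0; elim: gD0 x y => // {}D v gD IH Dv par bv prop mex.
have gDv : greedy A col b (rcons D v) by apply: greedy_rcons.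
have [propc loc] := Hc.
have sees y : y \in D -> c y <> c v -> exists z, [/\ z \in D, z \in A v & c z = c y].
  move=> Dy Nyv; have Dy' : y \in rcons D v by rewrite mem_rcons inE Dy orbT.
  have [|z [Dz zv Ez]] := greedy_sees (x := v) HA Hc gDv _ Dy'.
    by rewrite mem_rcons mem_head.
  case: zv => [E|zv]; first by case: Nyv; rewrite -Ez E.
  exists z; split=> //; move: Dz; rewrite mem_rcons inE => /orP[/eqP E|//].
  by move: zv; rewrite E (negbTE (adj_irr HA _)).
have key u : u \in D -> (col v == col u) = (c v == c u).
  move=> Du; apply/eqP/eqP => E; apply/eqP; apply/negPn/negP => /eqP N.
    have [z [Dz zv Ez]] := sees u Du (nesym N).
    apply: (prop z Dz zv); rewrite E; apply/eqP; rewrite IH //; exact/eqP.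
  have := gD => /greedy_gt/(_ Du) bu; case: (ltngtP (col v) (col u)) => // lt_uv.
    have [|w [Dw wu Ew]] := greedy_mex (a := col v) gD Du; first by rewrite bv.
    have Nw : c w <> c v by rewrite E; apply: propc.
    have [z [Dz zv Ez]] := sees w Dw Nw.
    by apply: (prop z Dz zv); rewrite -Ew; apply/eqP; rewrite IH // Ez.
  have [|w [Dw wv Ew]] := mex (col u); first by rewrite bu.
  by apply: (propc v w wv); rewrite E; apply/eqP; rewrite -IH // Ew.
move=> x y; rewrite !mem_rcons !inE => /orP[/eqP->|Dx] /orP[/eqP->|Dy].
- by rewrite !eqxx.
- exact: key.
- by rewrite eq_sym key // [RHS]eq_sym.
- exact: IH.
Qed.

Lemma greedy_multipartite n A col b D c x y t : adjacency n A ->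
  locally_perfect_nat A c -> greedy A col b D ->
  (forall u v, u \in D -> v \in A u -> v \in D) ->
  t \in D -> b.+2 < col t ->
  x \in D -> y \in D -> c x <> c y -> x \in A y.
Proof.
move=> HA Hc gD closed Dt bt Dx Dy Nxy.
have [prop loc] := Hc.
have agrees u v (Du : u \in D) (Dv : v \in D) := greedy_agrees HA Hc gD Du Dv.
have third u v : u \in D -> v \in D ->
    exists w, [/\ w \in D, c w <> c u & c w <> c v].
  move=> Du Dv.
  (* The colors [b.+1], [b.+2] and [b.+3] are all attained because [col t] exceeds [b.+2], and one
     of them differs from both given colors. *)
  have [a [a1 a2 a3]] : exists a, [/\ b < a <= b.+3, a <> col u & a <> col v].
    case: (b.+1 =P col u) => [E1|N1].
      case: (b.+2 =P col v) => [E2|N2]; first by exists b.+3; split; lia.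
      by exists b.+2; split; lia.
    case: (b.+1 =P col v) => [E2|N2]; last by exists b.+1; split; lia.
    case: (b.+2 =P col u) => [E3|N3]; first by exists b.+3; split; lia.
    by exists b.+2; split; lia.
  have [|w Dw Ew] := greedy_attained (a := a) gD Dt; first by lia.
  by exists w; split=> // /eqP; rewrite -agrees // Ew => /eqP.
(* The property to spread from [y]: being adjacent to [y], or having the color of [y] and, unless
   equal to [y], a common neighbor with it. The common neighbor keeps a link to [y] for the next
   edge. *)
pose P z := z \in A y \/ (c z = c y /\ (z = y \/ exists2 u, u \in A y & u \in A z)).
suff : P x by case=> // -[].
apply: (greedy_propagate (P := P) HA gD _ Dy Dx); last by right; split=> //; left.
move=> z w Dz Dw wz [zy|[Ezy zy]].
  have [wy|Ew] := loc y z w zy wz; first by left.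
  by right; split=> //; right; exists z; rewrite // (adj_sym HA).
left; case: zy => [<- //|[u uy uz]].
have zu : z \in A u by rewrite (adj_sym HA).
have yu : y \in A u by rewrite (adj_sym HA).
have zw : z \in A w by rewrite (adj_sym HA).
have nwy : c w <> c y by rewrite -Ezy; apply: prop.
have Du : u \in D := closed _ _ Dy uy.
have [E|N] := eqVneq (c w) (c u); last first.
  have [wu|E] := loc u z w zu wz; last by rewrite E eqxx in N.
  by have [|/nwy] := loc y u w uy wu.
(* Now [w] and [u] share a color. A neighbor [v'] of [z] in a third color is joined in turn to [u],
   [y] and [w], and the walk y, v', w yields the edge. *)
have [v [Dv nvz nvu]] := third z u Dz Du.
have [v' [Dv' vz Ev']] := greedy_sees HA Hc gD Dz Dv.
case: vz => [E1|vz]; first by case: nvz; rewrite -Ev' E1.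
have vu : v' \in A u.
  have [//|E1] := loc u z v' zu vz.
  by case: nvu; rewrite -Ev'.
have vy : v' \in A y.
  have [//|E1] := loc y u v' uy vu.
  by case: nvz; rewrite -Ev' Ezy.
have zv : z \in A v' by rewrite (adj_sym HA).
have wv : w \in A v'.
  have [//|E1] := loc v' z w zv wz.
  by case: nvu; rewrite -Ev' -E1.
by have [|/nwy] := loc y v' w vy wv.
Qed.

(** Necessity of the numerical test: once three colors occur, all vertices of the other colors are
    neighbors of [x]. *)
Lemma greedy_complete n A col b D c x t : adjacency n A ->
  locally_perfect_nat A c -> greedy A col b D ->
  (forall u v, u \in D -> v \in A u -> v \in D) ->
  t \in D -> b.+2 < col t -> x \in D ->
  size D <= size (A x) + count (fun y => col y == col x) D.
Proof.
move=> HA Hc gD closed Dt bt Dx.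
rewrite -(count_predC (fun y => col y == col x) D) addnC leq_add2r.
rewrite -size_filter; apply: uniq_leq_size.
  exact/filter_uniq/(greedy_uniq gD).
move=> y; rewrite mem_filter /= => /andP[N Dy].
apply: (greedy_multipartite HA Hc gD closed Dt bt Dy Dx) => /eqP.
by rewrite -(greedy_agrees HA Hc gD Dy Dx) (negbTE N).
Qed.

(** Sufficiency of the test. In the second case properness places the neighbors of [x] among the
    vertices of other colors, and the inequality makes the two sets equal. *)
Lemma greedy_sound n A col b D : adjacency n A -> greedy A col b D ->
  (forall u v, u \in D -> v \in A u -> v \in D) ->
  (forall x, x \in D -> col x <= b.+2) \/
  (forall x, x \in D -> size D <= size (A x) + count (fun y => col y == col x) D) ->
  forall x y z, x \in D -> y \in A x -> z \in A y -> z \in A x \/ col z = col x.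
Proof.
move=> HA gD closed ok x y z Dx xy yz.
have Dy := closed _ _ Dx xy; have Dz := closed _ _ Dy yz.
case: ok => [le2|ok].
  right; have := greedy_proper HA gD Dx Dy xy; have := greedy_proper HA gD Dy Dz yz.
  have := greedy_gt gD Dx; have := greedy_gt gD Dy; have := greedy_gt gD Dz.
  have := le2 x Dx; have := le2 y Dy; have := le2 z Dz; lia.
have [|N] := eqVneq (col z) (col x); [by right|left].
have sub : {subset A x <= [seq y <- D | col y != col x]}.
  move=> u ux; rewrite mem_filter (closed _ _ Dx ux) andbT; apply/eqP.
  exact: (greedy_proper HA gD Dx (closed _ _ Dx ux) ux).
have le_size : size [seq y <- D | col y != col x] <= size (A x).
  have := ok x Dx; rewrite -(count_predC (fun y => col y == col x) D) addnC leq_add2r.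
  by rewrite -size_filter.
have [_ ->] := uniq_min_size (adj_uniq HA x) sub le_size.
by rewrite mem_filter N.
Qed.

(** * A structured language over the machine *)

Inductive op : Type :=
| OConst of nat & nat
| OAdd of nat & nat & nat
| OSub of nat & nat & nat
| OLoad of nat & nat & nat
| OSave of nat & nat & nat
| ORead of nat
| OPrint of nat.

Inductive cmd : Type :=
| Op of op
| Seq of cmd & cmd
| While of nat & cmd
| When of nat & cmd.

Coercion Op : op >-> cmd.

(* The cell [i] of the array [a]; a scalar variable is the cell 0 of its own array. *)
Record state := State {
  cell : nat -> nat -> nat;
  inp : seq nat;
  out : seq nat;
  clk : nat
}.

Definition put (m : nat -> nat -> nat) (a i x : nat) : nat -> nat -> nat :=
  fun b j => if (b == a) && (j == i) then x else m b j.

Arguments put m a i x b j /.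

Definition tick (s : state) : state :=
  let: State m ii oo k := s in State m ii oo k.+1.

Definition do_op (o : op) (s : state) : state :=
  let: State m ii oo k := s in
  match o with
  | OConst x c => State (put m x 0 c) ii oo k.+1
  | OAdd x y z => State (put m x 0 (m y 0 + m z 0)) ii oo k.+1
  | OSub x y z => State (put m x 0 (m y 0 - m z 0)) ii oo k.+1
  | OLoad x a y => State (put m x 0 (m a (m y 0))) ii oo k.+1
  | OSave a x y => State (put m a (m x 0) (m y 0)) ii oo k.+1
  | ORead x => State (put m x 0 (head 0 ii)) (behead ii) oo k.+1
  | OPrint x => State m ii (rcons oo (m x 0)) k.+1
  end.

Inductive run : cmd -> state -> state -> Prop :=
| RunOp o s : run (Op o) s (do_op o s)
| RunSeq c1 c2 s1 s2 s3 : run c1 s1 s2 -> run c2 s2 s3 -> run (Seq c1 c2) s1 s3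
| RunWhile0 x c s : cell s x 0 = 0 -> run (While x c) s (tick s)
| RunWhileS x c s1 s2 s3 : 0 < cell s1 x 0 -> run c (tick s1) s2 ->
    run (While x c) s2 s3 -> run (While x c) s1 s3
| RunWhen0 x c s : cell s x 0 = 0 -> run (When x c) s (tick s)
| RunWhenS x c s1 s2 : 0 < cell s1 x 0 -> run c (tick s1) s2 ->
    run (When x c) s1 s2.

(** * Frame conditions and total correctness *)

Definition op_writes (o : op) : seq nat :=
  match o with
  | OConst x _ | OAdd x _ _ | OSub x _ _ | OLoad x _ _ | ORead x => [:: x]
  | OSave a _ _ => [:: a]
  | OPrint _ => [::]
  end.

Fixpoint writes (c : cmd) : seq nat :=
  match c with
  | Op o => op_writes o
  | Seq c1 c2 => writes c1 ++ writes c2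
  | While _ c1 | When _ c1 => writes c1
  end.

Fixpoint prints (c : cmd) : bool :=
  match c with
  | Op (OPrint _) => true
  | Op _ => false
  | Seq c1 c2 => prints c1 || prints c2
  | While _ c1 | When _ c1 => prints c1
  end.

(** This is the frame rule: [writes] and [prints] are syntactic, so every run returns its untouched
    variables at once and specifications mention only what changes. *)
Definition same_but (c : cmd) (s s' : state) : Prop :=
  (forall a i, a \notin writes c -> cell s' a i = cell s a i) /\
  (~~ prints c -> out s' = out s).

Lemma same_but_trans c s1 s2 s3 :
  same_but c s1 s2 -> same_but c s2 s3 -> same_but c s1 s3.
Proof.
move=> [A1 B1] [A2 B2]; split=> [a i Ha|H]; first by rewrite A2 // A1.
by rewrite B2 // B1.
Qed.

Lemma tick_same c s : same_but c s (tick s).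
Proof. by case: s. Qed.

Lemma run_same c s s' : run c s s' -> same_but c s s'.
Proof.
elim=> {c s s'}.
- move=> o [m ii oo k]; split; last by case: o.
  by case: o => [x c|x y z|x y z|x a y|a x y|x|x] b i //=;
     rewrite inE /put => /negbTE ->.
- move=> c1 c2 s1 s2 s3 _ [A1 B1] _ [A2 B2]; split=> /=.
    by move=> a i; rewrite mem_cat negb_or => /andP[H1 H2]; rewrite A2 // A1.
  by rewrite negb_or => /andP[H1 H2]; rewrite B2 // B1.
- by move=> x c s _; apply: tick_same.
- move=> x c s1 s2 s3 _ _ H1 _ H2.
  exact: same_but_trans (same_but_trans (tick_same c s1) H1) H2.
- by move=> x c s _; apply: tick_same.
- move=> x c s1 s2 _ _; exact: same_but_trans (tick_same c s1).
Qed.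

(** Total correctness: a terminating run is asserted. Since the clock belongs to the state, running
    times are ordinary postconditions. *)
Definition wp (c : cmd) (Q : state -> Prop) (s : state) : Prop :=
  exists2 s', run c s s' & Q s'.

Lemma wp_op o (Q : state -> Prop) s : Q (do_op o s) -> wp (Op o) Q s.
Proof. by move=> H; exists (do_op o s) => //; constructor. Qed.

Lemma wp_seq c1 c2 Q s : wp c1 (wp c2 Q) s -> wp (Seq c1 c2) Q s.
Proof.
by move=> [s1 H1 [s2 H2 HQ]]; exists s2 => //; apply: RunSeq H1 H2.
Qed.

Lemma wp_same c (Q Q' : state -> Prop) s : wp c Q s ->
  (forall s', Q s' -> same_but c s s' -> Q' s') -> wp c Q' s.
Proof.
by move=> [s' H HQ] HQ'; exists s' => //; apply: HQ' HQ (run_same H).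
Qed.

Lemma wp_when x c (Q : state -> Prop) s :
  (0 < cell s x 0 -> wp c Q (tick s)) -> (cell s x 0 = 0 -> Q (tick s)) ->
  wp (When x c) Q s.
Proof.
move=> H1 H0; case: (posnP (cell s x 0)) => H.
  by exists (tick s); [apply: RunWhen0|apply: H0].
by have [s' H2 H3] := H1 H; exists s' => //; apply: RunWhenS.
Qed.

(** The frame condition relative to the entry state is handed to the body and to the exit, so [I]
    need not repeat what the loop leaves alone. The measure [mu] serves termination only; time
    bounds are kept in [I]. *)
Lemma wp_while (I : state -> Prop) (mu : state -> nat) x c (Q : state -> Prop) s :
  I s ->
  (forall s', same_but c s s' -> I s' -> 0 < cell s' x 0 ->
     wp c (fun s2 => I s2 /\ mu s2 < mu s') (tick s')) ->
  (forall s', same_but c s s' -> I s' -> cell s' x 0 = 0 -> Q (tick s')) ->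
  wp (While x c) Q s.
Proof.
move=> HI Hbody Hend.
have F0 : same_but c s s by split.
have [k] := ubnP (mu s); elim: k {-2}s HI F0 => // k IH s1 HI F1 lt_mu.
case: (posnP (cell s1 x 0)) => H.
  by exists (tick s1); [apply: RunWhile0|apply: Hend].
have [s2 R2 [I2 mu2]] := Hbody s1 F1 HI H.
have F2 : same_but c s s2.
  exact: same_but_trans F1 (same_but_trans (tick_same c s1) (run_same R2)).
have [s3 R3 Q3] := IH s2 I2 F2 (leq_trans mu2 lt_mu).
by exists s3 => //; apply: RunWhileS R3.
Qed.

(* The cell [i] of the array [a < 30] lives in the register [a + 32 * i], which
   is computed by five doublings; the registers 30 and 31 are scratch. *)
Notation tmp := 30 (only parsing).
Notation tmp' := 31 (only parsing).

Definition address (a y : nat) : seq instr :=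
  [:: Add tmp y y; Add tmp tmp tmp; Add tmp tmp tmp; Add tmp tmp tmp;
      Add tmp tmp tmp; Const tmp' a; Add tmp tmp tmp'].

Definition compile_op (o : op) : seq instr :=
  match o with
  | OConst x c => [:: Const x c]
  | OAdd x y z => [:: Add x y z]
  | OSub x y z => [:: Defs.Sub x y z]
  | OLoad x a y => rcons (address a y) (Fetch x tmp)
  | OSave a x y => rcons (address a x) (Store tmp y)
  | ORead x => [:: Read x]
  | OPrint x => [:: Print x]
  end.

(** The argument [l] is the address of the first instruction, as jump targets are absolute. An
    unconditional jump tests the scratch register [tmp] just after setting it to 1. *)
Fixpoint compile (l : nat) (c : cmd) : program :=
  match c with
  | Op o => compile_op o
  | Seq c1 c2 => let p1 := compile l c1 in p1 ++ compile (l + size p1) c2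
  | While x c1 =>
      let p1 := compile (l + 3) c1 in
      [:: JumpPos x (l + 3); Const tmp 1; JumpPos tmp (l + 3 + size p1 + 2)] ++
      p1 ++ [:: Const tmp 1; JumpPos tmp l]
  | When x c1 =>
      let p1 := compile (l + 3) c1 in
      [:: JumpPos x (l + 3); Const tmp 1; JumpPos tmp (l + 3 + size p1)] ++ p1
  end.

Definition op_names (o : op) : seq nat :=
  match o with
  | OConst x _ | ORead x | OPrint x => [:: x]
  | OAdd x y z | OSub x y z | OLoad x y z | OSave x y z => [:: x; y; z]
  end.

Fixpoint well_named (c : cmd) : bool :=
  match c with
  | Op o => all (fun x : nat => x < 30) (op_names o)
  | Seq c1 c2 => well_named c1 && well_named c2
  | While x c1 | When x c1 => (x < 30) && well_named c1
  end.

(** * Correctness of the compilation *)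

(** Only arrays numbered below 30 are constrained, which leaves the scratch registers free. *)
Definition represents (s : state) (g : config) : Prop :=
  [/\ forall a i, a < 30 -> reg g (a + 32 * i) = cell s a i,
      input g = inp s & output g = out s].

Definition code_at (p : program) (l : nat) (q : program) : Prop :=
  exists p1 p2, p = p1 ++ q ++ p2 /\ size p1 = l.

Lemma code_at_catl p l q1 q2 : code_at p l (q1 ++ q2) -> code_at p l q1.
Proof. by move=> [p1 [p2 [-> <-]]]; exists p1, (q2 ++ p2); rewrite -!catA. Qed.

Lemma code_at_catr p l q1 q2 :
  code_at p l (q1 ++ q2) -> code_at p (l + size q1) q2.
Proof.
move=> [p1 [p2 [-> <-]]]; exists (p1 ++ q1), p2.
by rewrite size_cat -!catA.
Qed.

Lemma code_at_step p i q g : code_at p (pc g) (i :: q) ->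
  step p g = exec i g /\ code_at p (pc g).+1 q.
Proof.
move=> [p1 [p2 [E H]]]; split; last first.
  by exists (rcons p1 i), p2; rewrite E cat_rcons size_rcons H.
rewrite /step; suff -> : onth p (pc g) = Some i by [].
by rewrite E -H onth_cat ltnn subnn.
Qed.

Lemma cell_address a i b j : a < 32 -> b < 32 ->
  (a + 32 * i == b + 32 * j) = (a == b) && (i == j).
Proof.
move=> Ha Hb; apply/eqP/andP=> [H|[/eqP-> /eqP->] //].
by split; apply/eqP; lia.
Qed.

Definition straight (i : instr) : bool := if i is JumpPos _ _ then false else true.

Lemma run_straight p q g : all straight q -> code_at p (pc g) q ->
  let g' := foldl (fun h i => exec i h) g q in
  iter (size q) (step p) g = g' /\ pc g' = pc g + size q.
Proof.
elim: q g => [|i q IH] g /=; first by rewrite addn0.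
move=> /andP[Hi Hq] H; have [E H1] := code_at_step H.
have Epc : pc (exec i g) = (pc g).+1 by case: g {H E H1} => l r ii oo; case: i Hi.
rewrite -Epc in H1; have [<- ->] := IH _ Hq H1.
by rewrite -iterS iterSr E Epc addnS addSn.
Qed.

Lemma address_correct a y l r gi go : y < 30 ->
  exists l' r', [/\ foldl (fun h i => exec i h) (Config l r gi go) (address a y)
      = Config l' r' gi go, r' tmp = a + 32 * r y
    & forall j, j != tmp -> j != tmp' -> r' j = r j].
Proof.
move=> Hy; do 2!eexists; split; first by [].
  by rewrite /upd /=; lia.
by move=> j /negbTE H /negbTE H'; rewrite /upd H H'.
Qed.

Lemma compile_op_correct o s g : all (fun x : nat => x < 30) (op_names o) ->
  represents s g ->
  represents (do_op o s) (foldl (fun h i => exec i h) g (compile_op o)).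
Proof.
case: s g => m ii oo k [l r gi go] Ho [/= Hr Ei Eo].
have rs a : a < 30 -> r a = m a 0 by move=> Ha; rewrite -(Hr a 0 Ha) muln0 addn0.
have A a b i : a < 32 -> b < 30 -> (b + 32 * i == a) = (b == a) && (i == 0).
  by move=> Ha Hb; rewrite -(@cell_address b i a 0) ?muln0 ?addn0 //; lia.
case: o Ho => [x c|x y z|x y z|x a y|a x y|x|x]; rewrite [all _ _]/= ?andbT => Ho;
  try (case/and3P: Ho => Hx Hy Hz).
- by split=> //= b i Hb; rewrite /upd /put A ?Hr //; lia.
- by split=> //= b i Hb; rewrite /upd /put A ?Hr ?rs //; lia.
- by split=> //= b i Hb; rewrite /upd /put A ?Hr ?rs //; lia.
- rewrite /compile_op foldl_rcons.
  have [l' [r' [-> E R]]] := address_correct a l r gi go Hz.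
  have R' b i : b < 30 -> r' (b + 32 * i) = m b i.
    by move=> Hb; rewrite R ?Hr //; lia.
  by split=> //= b i Hb; rewrite /upd /put A ?E ?rs ?R' //; lia.
- rewrite /compile_op foldl_rcons.
  have [l' [r' [-> E R]]] := address_correct a l r gi go Hy.
  have R' b i : b < 30 -> r' (b + 32 * i) = m b i.
    by move=> Hb; rewrite R ?Hr //; lia.
  split=> //= b i Hb; rewrite /upd /put E cell_address; try lia.
  by rewrite R' // rs // R ?rs //; lia.
- by split=> [b i Hb||] //=; rewrite /upd /put ?A ?Hr ?Ei //; lia.
- by split=> //=; rewrite rs // Eo.
Qed.

Lemma compile_op_straight o : all straight (compile_op o).
Proof. by case: o. Qed.

(** The worst case is seven instructions for an address and one memory access. *)
Lemma size_compile_op o : size (compile_op o) <= 8.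
Proof. by case: o. Qed.

Lemma represents_tick s g : represents s g -> represents (tick s) g.
Proof. by case: s. Qed.

Lemma clk_do_op o s : clk (do_op o s) = (clk s).+1.
Proof. by case: s => m ii oo k; case: o. Qed.

Lemma clk_tick s : clk (tick s) = (clk s).+1.
Proof. by case: s. Qed.

Lemma guard_represents s l r ii oo x : x < 30 -> represents s (Config l r ii oo) ->
  r x = cell s x 0.
Proof. by move=> Hx [H _ _]; rewrite -(H x 0 Hx) muln0 addn0. Qed.

Lemma upd_tmp_represents s l l' r ii oo x : represents s (Config l r ii oo) ->
  represents s (Config l' (upd r tmp x) ii oo).
Proof.
move=> [H H1 H2]; split=> // a i Ha; rewrite -H //= /upd.
by case: eqP => //; lia.
Qed.

Lemma iter_steps p t1 t2 g g1 g2 :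
  iter t1 (step p) g = g1 -> iter t2 (step p) g1 = g2 ->
  iter (t2 + t1) (step p) g = g2.
Proof. by rewrite iterD => ->. Qed.

(* Every tick of the source pays for eight machine steps. *)
Lemma compile_correct p c s s' : run c s s' -> well_named c ->
  forall g, represents s g -> code_at p (pc g) (compile (pc g) c) ->
  exists t g', [/\ iter t (step p) g = g', t + 8 * clk s <= 8 * clk s',
    represents s' g' & pc g' = pc g + size (compile (pc g) c)].
Proof.
elim=> {c s s'}.
- move=> o s /= Ho g Hg Hc.
  have [E1 E2] := run_straight (compile_op_straight o) Hc.
  exists (size (compile_op o)), (foldl (fun h i => exec i h) g (compile_op o)).
  split=> //; last exact: compile_op_correct.
  by have := size_compile_op o; rewrite clk_do_op; lia.
- move=> c1 c2 s1 s2 s3 _ IH1 _ IH2 /= /andP[W1 W2] g Hg Hc.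
  have [t1 [g1 [E1 L1 H1 P1]]] := IH1 W1 g Hg (code_at_catl Hc).
  have := code_at_catr Hc; rewrite -P1 => Hc2.
  have [t2 [g2 [E2 L2 H2 P2]]] := IH2 W2 g1 H1 Hc2.
  exists (t2 + t1), g2; split=> //; first exact: iter_steps E1 E2.
    by lia.
  by rewrite P2 P1 size_cat addnA.
- move=> x c s H0 /= /andP[Hx W] [l r ii oo] Hg /= Hc.
  set p1 := compile _ _ in Hc *.
  have [S1 C1] := @code_at_step p _ _ (Config l r ii oo) Hc.
  have S1' : step p (Config l r ii oo) = Config l.+1 r ii oo.
    by rewrite S1 /= (guard_represents Hx Hg) H0.
  have [S2 C2] := @code_at_step p _ _ (Config l.+1 r ii oo) C1.
  have [S3 C3] := @code_at_step p _ _ (Config l.+2 (upd r tmp 1) ii oo) C2.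
  exists 3, (Config (l + 3 + size p1 + 2) (upd r tmp 1) ii oo); split.
  + by rewrite 3!iterS S1' S2 S3.
  + by rewrite clk_tick; lia.
  + exact: represents_tick (upd_tmp_represents _ _ Hg).
  + by rewrite /= size_cat /=; lia.
- move=> x c s1 s2 s3 Hpos _ IH1 _ IH2 W.
  have /= /andP[Hx W1] := W => -[l r ii oo] Hg Hc.
  have [S1 C1] := @code_at_step p _ _ (Config l r ii oo) Hc.
  have S1' : step p (Config l r ii oo) = Config (l + 3) r ii oo.
    by rewrite S1 /= (guard_represents Hx Hg) Hpos.
  set p1 := compile (l + 3) c in Hc *.
  have Hc1 : code_at p (l + 3) (p1 ++ [:: Const tmp 1; JumpPos tmp l]).
    by apply: (@code_at_catr p l [:: _; _; _]) Hc.
  have Hg1 : represents (tick s1) (Config (l + 3) r ii oo).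
    by apply: represents_tick; case: Hg.
  have [t1 [[l2 r2 ii2 oo2] [E1 L1 H1 P1]]] :=
    IH1 W1 (Config (l + 3) r ii oo) Hg1 (code_at_catl Hc1).
  rewrite /= -/p1 in P1; have := code_at_catr Hc1; rewrite -P1 => Hc2.
  have [S2 C2] := @code_at_step p _ _ (Config l2 r2 ii2 oo2) Hc2.
  have [S3 C3] := @code_at_step p _ _ (Config l2.+1 (upd r2 tmp 1) ii2 oo2) C2.
  have [t2 [g3 [E3 L3 H3 P3]]] :=
    IH2 W (Config l (upd r2 tmp 1) ii2 oo2) (upd_tmp_represents _ _ H1) Hc.
  exists (t2 + (2 + (t1 + 1))), g3; split=> //.
  + apply: iter_steps E3.
    have E2 : iter 2 (step p) (Config l2 r2 ii2 oo2) =
              Config l (upd r2 tmp 1) ii2 oo2 by rewrite /= S2 S3.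
    by apply: iter_steps E2; apply: iter_steps E1; rewrite iterS S1'.
  + by rewrite clk_tick in L1; lia.
- move=> x c s H0 /= /andP[Hx W] [l r ii oo] Hg /= Hc.
  set p1 := compile _ _ in Hc *.
  have [S1 C1] := @code_at_step p _ _ (Config l r ii oo) Hc.
  have S1' : step p (Config l r ii oo) = Config l.+1 r ii oo.
    by rewrite S1 /= (guard_represents Hx Hg) H0.
  have [S2 C2] := @code_at_step p _ _ (Config l.+1 r ii oo) C1.
  have [S3 C3] := @code_at_step p _ _ (Config l.+2 (upd r tmp 1) ii oo) C2.
  exists 3, (Config (l + 3 + size p1) (upd r tmp 1) ii oo); split.
  + by rewrite 3!iterS S1' S2 S3.
  + by rewrite clk_tick; lia.
  + exact: represents_tick (upd_tmp_represents _ _ Hg).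
  + by rewrite /=; lia.
- move=> x c s1 s2 Hpos _ IH1 /= /andP[Hx W] [l r ii oo] Hg /= Hc.
  have [S1 C1] := @code_at_step p _ _ (Config l r ii oo) Hc.
  have S1' : step p (Config l r ii oo) = Config (l + 3) r ii oo.
    by rewrite S1 /= (guard_represents Hx Hg) Hpos.
  set p1 := compile (l + 3) c in Hc *.
  have Hc1 : code_at p (l + 3) p1 by apply: (@code_at_catr p l [:: _; _; _]) Hc.
  have Hg1 : represents (tick s1) (Config (l + 3) r ii oo).
    by apply: represents_tick; case: Hg.
  have [t1 [g2 [E1 L1 H1 P1]]] := IH1 W (Config (l + 3) r ii oo) Hg1 Hc1.
  exists (t1 + 1), g2; split=> //.
  + by apply: iter_steps E1; rewrite iterS S1'.
  + by rewrite clk_tick in L1; lia.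
  + by rewrite P1 /= -/p1; lia.
Qed.

Definition start_state (ii : seq nat) : state := State (fun _ _ => 0) ii [::] 0.

Lemma compile_halts c ii oo k : well_named c ->
  wp c (fun s => out s = oo /\ clk s <= k) (start_state ii) ->
  halts_within (compile 0 c) ii (8 * k) oo.
Proof.
move=> W [s R [E L]].
have H0 : represents (start_state ii) (init ii) by split.
have C0 : code_at (compile 0 c) 0 (compile 0 c).
  by exists [::], [::]; rewrite cats0.
have [t [g [Et Lt Hg Pg]]] := compile_correct R W H0 C0.
exists t; first by move: Lt => /=; lia.
rewrite Et; split; first by rewrite /halted Pg.
by case: Hg => _ _ ->.
Qed.

(** * The algorithm *)

Notation "c1 ;; c2" := (Seq c1 c2) (at level 90, right associativity, only parsing).
Notation vN := 0 (only parsing).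
Notation vOne := 1 (only parsing).
Notation vR := 2 (only parsing).
Notation vP := 3 (only parsing).
Notation vK := 4 (only parsing).
Notation vW := 5 (only parsing).
Notation vT := 6 (only parsing).
Notation vTail := 7 (only parsing).
Notation vHead := 8 (only parsing).
Notation vFirst := 9 (only parsing).
Notation vBase := 10 (only parsing).
Notation vTop := 11 (only parsing).
Notation vV := 12 (only parsing).
Notation vC := 13 (only parsing).
Notation vU := 14 (only parsing).
Notation vBad := 15 (only parsing).
Notation vS := 16 (only parsing).
Notation aDeg := 17 (only parsing).
Notation aStart := 18 (only parsing).
Notation aAdj := 19 (only parsing).
Notation aQueue := 20 (only parsing).
Notation aSeen := 21 (only parsing).
Notation aCol := 22 (only parsing).
Notation aMark := 23 (only parsing).
Notation aCnt := 24 (only parsing).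

(** * Reading the input *)

Definition read_neighbors : cmd :=
  While vK (ORead vW ;; OSave aAdj vP vW ;; OAdd vP vP vOne ;; OSub vK vK vOne).

Definition load : cmd :=
  ORead vN ;; OConst vOne 1 ;; OSub vT vN vR ;;
  While vT (
    ORead vK ;; OSave aDeg vR vK ;; OSave aStart vR vP ;; read_neighbors ;;
    OAdd vR vR vOne ;; OSub vT vN vR).

(** The unit of account for all time bounds: a vertex pays for itself and for each of its neighbors,
    so all vertices together weigh n plus the sum of the degrees. *)
Definition weight (A : nat -> seq nat) (q : seq nat) : nat :=
  sumn [seq (size (A x)).+1 | x <- q].

Lemma weight_cat A q1 q2 : weight A (q1 ++ q2) = weight A q1 + weight A q2.
Proof. by rewrite /weight map_cat sumn_cat. Qed.

Lemma weight_rcons A q x : weight A (rcons q x) = weight A q + (size (A x)).+1.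
Proof. by rewrite -cats1 weight_cat /weight /= addn0. Qed.

Definition loaded_upto (A : nat -> seq nat) (n : nat) (s : state) : Prop :=
  forall v, v < n -> cell s aDeg v = size (A v) /\
    forall j, j < size (A v) -> cell s aAdj (cell s aStart v + j) = nth 0 (A v) j.

Ltac wp_step := first [apply: wp_seq | apply: wp_op => /=].
Ltac wp_steps := repeat wp_step.

Lemma read_neighbors_spec l rest s :
  cell s vOne 0 = 1 -> cell s vK 0 = size l -> inp s = l ++ rest ->
  wp read_neighbors (fun s' => [/\ cell s' vP 0 = cell s vP 0 + size l,
    forall j, j < size l -> cell s' aAdj (cell s vP 0 + j) = nth 0 l j,
    forall i, i < cell s vP 0 -> cell s' aAdj i = cell s aAdj i,
    inp s' = rest & clk s' <= clk s + 5 * size l + 1]) s.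
Proof.
move=> E1 EK Ei.
pose I s' := exists j, [/\ j <= size l, cell s' vK 0 = size l - j,
  cell s' vP 0 = cell s vP 0 + j, inp s' = drop j l ++ rest &
  [/\ forall i, i < j -> cell s' aAdj (cell s vP 0 + i) = nth 0 l i,
   forall i, i < cell s vP 0 -> cell s' aAdj i = cell s aAdj i
   & clk s' <= clk s + 5 * j]].
apply: (wp_while (I := I) (mu := fun s' => cell s' vK 0)).
- exists 0; rewrite drop0 subn0 addn0 Ei; do 2!split=> //; lia.
- move=> [m ii oo k] [F _] [j [le_j HK HP Hi [HA HA' Hk]]] /= Hpos.
  have M1 := F vOne 0 isT; rewrite E1 /= in M1.
  move: HK HP Hi HA HA' Hk Hpos => /= HK HP Hi HA HA' Hk Hpos.
  have lt_j : j < size l by lia.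
  rewrite (drop_nth 0 lt_j) in Hi.
  wp_steps; rewrite HP Hi M1 /=; split; last by lia.
  exists j.+1; split=> //=; try lia.
  split=> [i lt_i|i lt_i|] /=; last by lia.
    have [E|N] := eqVneq i j; first by rewrite E eqxx.
    by rewrite eqn_add2l (negbTE N) HA //; lia.
  by rewrite ltn_eqF ?HA' //; lia.
- move=> [m ii oo k] [F _] [j [le_j /= HK HP Hi [HA HA' Hk]]] Hz.
  have Ej : j = size l by lia.
  by subst j; split=> //=; [rewrite Hi drop_size|lia].
Qed.

Lemma load_spec A n rest :
  wp load (fun s => [/\ cell s vN 0 = n, cell s vOne 0 = 1, loaded_upto A n s &
      clk s <= 7 * weight A (iota 0 n) + 4])
    (start_state (n :: flatten [seq size (A v) :: A v | v <- iota 0 n] ++ rest)).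
Proof.
rewrite /load; wp_steps.
(* The blocks of earlier vertices end no later than [vP], so the lists still to be read do not
   overwrite them. *)
pose I s' := exists i, [/\ i <= n, cell s' vR 0 = i, cell s' vT 0 = n - i,
  inp s' = flatten [seq size (A v) :: A v | v <- iota i (n - i)] ++ rest &
  [/\ loaded_upto A i s',
    forall v, v < i -> cell s' aStart v + size (A v) <= cell s' vP 0
    & clk s' <= 7 * weight A (iota 0 i) + 3]].
apply: (wp_while (I := I) (mu := fun s' => cell s' vT 0)).
- by exists 0; rewrite subn0.
- move=> [m ii oo k] [F _] [i [le_i HR HT Hi [HA HP Hk]]] /= Hpos.
  have M0 : m 0 0 = n := F vN 0 isT; have M1 : m 1 0 = 1 := F vOne 0 isT.
  move: HR HT Hi HA HP Hk Hpos => /= HR HT Hi HA HP Hk Hpos.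
  have E : n - i = (n - i.+1).+1 by lia.
  rewrite E /= -catA in Hi.
  wp_steps; rewrite HR Hi /=.
  apply: wp_same; first by apply: (@read_neighbors_spec (A i)).
  move=> [m1 ii1 oo1 k1] [/= P1 HA1 HA1' I1 K1] F1_; have [/= F1 _] := F1_.
  have M10 := F1 vN 0 isT; have M11 := F1 vOne 0 isT; have M1R := F1 vR 0 isT.
  have M1D := F1 aDeg _ isT; have M1S := F1 aStart _ isT.
  move: M10 M11 M1R M1D M1S => /= M10 M11 M1R M1D M1S.
  wp_steps; rewrite M10 M11 M1R M0 M1 HR; split; last by lia.
  exists i.+1; split=> //=; try lia.
  split=> /= [v lt_v|v lt_v|].
  + rewrite /= M1D M1S; have [Ev|Nv] := eqVneq v i.
      by rewrite Ev ?eqxx; split=> // j lt_j; rewrite HA1.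
    have lt_vi : v < i by lia.
    have [/= -> HA2] := HA v lt_vi; split=> // j lt_j.
    by rewrite HA1' ?HA2 //; have := HP v lt_vi; rewrite /=; lia.
  + rewrite /= M1S; have [Ev|Nv] := eqVneq v i; first by rewrite Ev P1.
    rewrite P1; have lt_vi : v < i by lia.
    by have := HP v lt_vi; rewrite /=; lia.
  + have Ei : 0 :: iota 1 i = iota 0 i ++ [:: i] by rewrite -(iotaD 0 i 1) addn1.
    by rewrite Ei cats1 weight_rcons; lia.
- move=> [m ii oo k] [F _] [i [le_i /= HR HT Hi [HA HP Hk]]] Hz.
  have Ei : i = n by lia.
  rewrite Ei in HA Hk.
  by split; [exact: (F vN 0 isT)|exact: (F vOne 0 isT)|exact: HA|rewrite /=; lia].
Qed.

(* [aMark] is never reset: a color is taken at the current visit when its mark is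
   [vHead], which grows at every visit.  Likewise each component uses colors
   above [vBase], the largest color so far, so [aCnt] is never reset. *)
Definition scan : cmd :=
  While vK (
    OLoad vW aAdj vP ;; OAdd vP vP vOne ;; OSub vK vK vOne ;;
    OLoad vC aCol vW ;; OSave aMark vC vHead ;;
    OLoad vU aSeen vW ;; OSub vU vOne vU ;;
    When vU (OSave aSeen vW vOne ;; OSave aQueue vTail vW ;;
             OAdd vTail vTail vOne)).

(** The list [q] holds every vertex discovered so far, those of finished components included,
    because entries that [vHead] has passed stay in place. The seen flags are coerced booleans. *)
Definition queue_is (s : state) (q : seq nat) : Prop :=
  [/\ cell s vTail 0 = size q, forall i, i < size q -> cell s aQueue i = nth 0 q i
    & forall w, cell s aSeen w = (w \in q)].

Lemma scan_spec l q s :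
  cell s vOne 0 = 1 -> cell s vK 0 = size l ->
  (forall j, j < size l -> cell s aAdj (cell s vP 0 + j) = nth 0 l j) ->
  queue_is s q -> uniq q -> (forall a, cell s aMark a < cell s vHead 0) ->
  wp scan (fun s' => exists new, [/\ queue_is s' (q ++ new), uniq (q ++ new),
    {subset new <= l}, {subset l <= q ++ new} &
    [/\ forall a, cell s' aMark a <= cell s vHead 0,
      forall a, (cell s' aMark a == cell s vHead 0) = (a \in [seq cell s aCol w | w <- l])
      & clk s' <= clk s + 12 * size l + 1]]) s.
Proof.
move=> E1 EK EA Hq Uq HM.
pose I s' := exists j new, [/\ j <= size l, cell s' vK 0 = size l - j,
  cell s' vP 0 = cell s vP 0 + j, queue_is s' (q ++ new) &
  [/\ uniq (q ++ new), {subset new <= take j l}, {subset take j l <= q ++ new} &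
  [/\ forall a, cell s' aMark a <= cell s vHead 0,
      forall a, (cell s' aMark a == cell s vHead 0) =
        (a \in [seq cell s aCol w | w <- take j l])
      & clk s' <= clk s + 12 * j]]].
apply: (wp_while (I := I) (mu := fun s' => cell s' vK 0)).
- exists 0, [::]; rewrite cats0 take0 addn0 subn0 muln0 addn0.
  do 2!split=> //; split=> // a; first exact: ltnW.
  by rewrite in_nil ltn_eqF.
- move=> [m ii oo k] [F _] [j [new [le_j HK HP [Qt Qi Qs] [U' sub1 sub2 [M1 M2 Hk]]]]] Hpos.
  have e1 := F vOne 0 isT; have eA := F aAdj _ isT; have eC := F aCol _ isT.
  have eH := F vHead 0 isT; rewrite E1 in e1.
  move: e1 eA eC eH HK HP Qt Qi Qs M1 M2 Hk Hpos => /= e1 eA eC eH HK HP Qt Qi Qs M1 M2 Hk Hpos.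
  have lt_j : j < size l by lia.
  set w := nth 0 l j.
  have Ew : m aAdj (m vP 0) = w by rewrite eA HP EA.
  have take_j : take j.+1 l = rcons (take j l) w by rewrite -take_nth.
  have markP a : ((if a == cell s aCol w then cell s vHead 0 else m aMark a)
      == cell s vHead 0) = (a \in [seq cell s aCol w | w <- take j.+1 l]).
    rewrite take_j map_rcons mem_rcons inE -M2.
    by case: (a == cell s aCol w) => //=; rewrite eqxx.
  have mark_le a : (if a == cell s aCol w then cell s vHead 0 else m aMark a)
      <= cell s vHead 0 by case: eqP.
  have sub1' : {subset new <= take j.+1 l}.
    by move=> x /sub1; rewrite take_j mem_rcons inE orbC => ->.
  wp_steps; rewrite Ew e1 eC eH Qs /=.
  apply: wp_when => /=.
    case: (boolP (w \in q ++ new)) => // Nw _.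
    wp_steps; rewrite e1 Qt HK HP; split; last by lia.
    exists j.+1, (rcons new w); rewrite -rcons_cat; split=> //=; try lia.
      split=> /= [|i|x]; first by rewrite size_rcons; lia.
        rewrite size_rcons nth_rcons => lt_i; case: (ltngtP i (size (q ++ new))) => //.
          by move=> lt'; apply: Qi.
        by move=> lt'; lia.
      by rewrite Qs mem_rcons inE; case: eqP.
    split=> //=.
    + by rewrite rcons_uniq Nw.
    + by move=> x; rewrite mem_rcons inE => /orP[/eqP->|/sub1' //];
        rewrite take_j mem_rcons mem_head.
    + move=> x; rewrite take_j !mem_rcons !inE => /orP[->//|/sub2 ->].
      by rewrite orbT.
    + by split=> //; lia.
  case: (boolP (w \in q ++ new)) => // qw _.
  split; last by rewrite /=; lia.
  exists j.+1, new; split=> //=; try lia.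
  split=> //=; last by split=> //; lia.
  by move=> x; rewrite take_j mem_rcons inE => /orP[/eqP->//|/sub2].
- move=> [m ii oo k] [F _] [j [new [le_j HK HP Hq' [U' sub1 sub2 [M1 M2 Hk]]]]] Hz.
  rewrite /= in HK Hk Hz; have Ej : j = size l by lia.
  rewrite Ej take_size in sub1 sub2 M2 Hk.
  by exists new; split=> //; split=> //=; lia.
Qed.

(** Marks never exceed [vHead], so the double truncated subtraction leaves 1 in [vU] exactly when
    the mark of color [vC] equals [vHead], and 0 otherwise. *)
Definition test_mark : cmd :=
  OLoad vU aMark vC ;; OSub vU vHead vU ;; OSub vU vOne vU.

Definition mex : cmd :=
  OAdd vC vBase vOne ;; test_mark ;; While vU (OAdd vC vC vOne ;; test_mark).

Lemma mex_spec (cs : seq nat) s :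
  cell s vOne 0 = 1 -> (forall a, cell s aMark a <= cell s vHead 0) ->
  (forall a, (cell s aMark a == cell s vHead 0) = (a \in cs)) ->
  wp mex (fun s' => [/\ cell s vBase 0 < cell s' vC 0, cell s' vC 0 \notin cs,
    forall a, cell s vBase 0 < a < cell s' vC 0 -> a \in cs
    & clk s' <= clk s + 5 * size cs + 5]) s.
Proof.
case: s => m ii oo k /= E1 HM1 HM2.
have mark_in a : 1 - (m vHead 0 - m aMark a) = (a \in cs).
  rewrite -HM2; have := HM1 a; case: eqP => [->|]; lia.
rewrite /mex /test_mark; wp_steps; rewrite E1 mark_in.
pose I s' := exists j, [/\ cell s' vC 0 = m vBase 0 + j.+1,
  {subset iota (m vBase 0).+1 j <= cs}, cell s' vU 0 = (cell s' vC 0 \in cs)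
  & clk s' <= k + 4 + 5 * j].
(* The rejected colors are distinct members of [cs], so there are at most [size cs] rejections; this
   bounds the time by the degree. *)
have small j : {subset iota (m vBase 0).+1 j <= cs} -> j <= size cs.
  by move=> H; rewrite -(size_iota (m vBase 0).+1 j) uniq_leq_size ?iota_uniq.
apply: (wp_while (I := I) (mu := fun s' => m vBase 0 + size cs + 1 - cell s' vC 0)).
- by exists 0; split=> //=; lia.
- move=> [m1 ii1 oo1 k1] [F _] [j [HC sub HU Hk]] /=.
  have M1 := F vOne 0 isT; have MH := F vHead 0 isT; have MM := F aMark _ isT.
  move: M1 MH MM HC sub HU Hk => /= M1 MH MM HC sub HU Hk; rewrite HU => Hpos.
  have C_in : m1 vC 0 \in cs by case: (_ \in cs) Hpos.
  have sub' : {subset iota (m vBase 0).+1 j.+1 <= cs}.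
    move=> a; rewrite mem_iota addSnnS => /andP[lt_a].
    case: (eqVneq a (m1 vC 0)) => [-> //|N le_a].
    by apply: sub; rewrite mem_iota; lia.
  have := small _ sub' => le_j.
  wp_steps; rewrite M1 E1 MH MM mark_in; split; last by lia.
  by exists j.+1; split=> //=; lia.
- move=> [m1 ii1 oo1 k1] [F _] [j [/= HC sub HU Hk]] Hz.
  have := small _ sub => le_j.
  split=> [||a /andP[lt_a lt_a']|] /=.
  + by lia.
  + by move: Hz; rewrite /= HU; case: (_ \in cs).
  + rewrite /= HC in lt_a'; rewrite /= in lt_a.
    by apply: sub; rewrite mem_iota; lia.
  + by lia.
Qed.

(** * Breadth-first search within a component *)

(** [vHead] is advanced before the scan, so that all existing marks are out of date. Adding the
    truncated difference of [vC] and [vTop] to [vTop] takes a maximum, and [vT] ends as the number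
    of waiting vertices. *)
Definition visit : cmd :=
  OLoad vV aQueue vHead ;; OAdd vHead vHead vOne ;;
  OLoad vP aStart vV ;; OLoad vK aDeg vV ;; scan ;; mex ;;
  OSave aCol vV vC ;; OLoad vU aCnt vC ;; OAdd vU vU vOne ;; OSave aCnt vC vU ;;
  OSub vU vC vTop ;; OAdd vTop vTop vU ;; OSub vT vTail vHead.

(* [old]: the vertices of the finished components; [D] and [todo]: the visited
   and the waiting vertices of the current one. *)
Record searching (n : nat) (A : nat -> seq nat) (old D todo : seq nat)
    (s : state) : Prop := Searching {
  s_queue : queue_is s (old ++ D ++ todo);
  s_uniq : uniq (old ++ D ++ todo);
  s_bound : forall x, x \in old ++ D ++ todo -> x < n;
  s_first : cell s vFirst 0 = size old;
  s_head : cell s vHead 0 = size (old ++ D);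
  s_mark : forall a, cell s aMark a <= cell s vHead 0;
  s_uncolored : forall x, x \notin old ++ D -> cell s aCol x = 0;
  s_count : forall a, cell s aCnt a = count (fun x => cell s aCol x == a) (old ++ D);
  s_old : forall x y, x \in old -> y \in A x -> y \in old;
  s_closed : forall x y, x \in D -> y \in A x -> y \in D ++ todo;
  s_old_le : forall x, x \in old -> cell s aCol x <= cell s vBase 0;
  s_base_top : cell s vBase 0 <= cell s vTop 0;
  s_le_top : forall x, x \in D -> cell s aCol x <= cell s vTop 0;
  s_top : cell s vTop 0 = cell s vBase 0 \/
          exists2 x, x \in D & cell s aCol x = cell s vTop 0;
  s_greedy : greedy A (cell s aCol) (cell s vBase 0) D;
  s_parent : (D = [::] /\ size todo = 1) \/
             (forall x, x \in todo -> exists2 y, y \in D & y \in A x)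
}.

Lemma searching_size n A old D todo s :
  searching n A old D todo s -> size (old ++ D ++ todo) <= n.
Proof.
move=> H; rewrite -(size_iota 0 n) uniq_leq_size ?(s_uniq H) // => x /(s_bound H).
by rewrite mem_iota.
Qed.

(** For degree d the budget is 12 d + 1 for [scan], 5 d + 5 for [mex] and eleven single
    operations. *)
Lemma visit_spec n A old D v todo s : adjacency n A ->
  cell s vOne 0 = 1 -> loaded_upto A n s ->
  searching n A old D (v :: todo) s ->
  wp visit (fun s' => exists new, [/\ searching n A old (rcons D v) (todo ++ new) s',
    cell s' vT 0 = size (todo ++ new),
    forall x, x \in old -> cell s' aCol x = cell s aCol x & clk s' <= clk s + 17 * (size (A v)).+1]) s.
Proof.
move=> HA; case: s => m ii oo k /= E1 HL H.
have [Qt Qi Qs] := s_queue H; rewrite /= in Qt Qi Qs.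
have U := s_uniq H; have B := s_bound H; have Fi := s_first H; have Hd := s_head H.
have Mk := s_mark H; have Uc := s_uncolored H; have Cn := s_count H.
have Ol := s_old H; have Cl := s_closed H; have Ole := s_old_le H.
have Bt := s_base_top H; have Le := s_le_top H; have Tp := s_top H.
have G := s_greedy H; have Pa := s_parent H.
rewrite /= in Fi Hd Mk Uc Cn Ole Bt Le Tp G.
set q := old ++ D ++ v :: todo in Qt Qi Qs U B.
have size_q : size q = size (old ++ D) + (size todo).+1 by rewrite /q catA size_cat.
have Ev : m aQueue (m vHead 0) = v.
  rewrite Hd Qi ?size_q; last by lia.
  by rewrite /q catA nth_cat ltnn subnn.
have qv : v \in q by rewrite /q !mem_cat mem_head !orbT.
have ltv := B v qv; have [Dv Av] := HL v ltv; rewrite /= in Dv Av.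
rewrite /visit; wp_steps; rewrite Ev E1 Dv.
apply: wp_same.
  apply: (@scan_spec (A v) q) => //=.
  by move=> a; have := Mk a; lia.
move=> [m1 ii1 oo1 k1] [new /= [[Q1t Q1i Q1s] U1 sub1 sub2 [M1 M1' K1]]] F1_.
have [/= F1 _] := F1_; rewrite /= in Q1t Q1i Q1s.
have F1one := F1 vOne 0 isT; have F1col := F1 aCol _ isT; have F1cnt := F1 aCnt _ isT.
have F1base := F1 vBase 0 isT; have F1top := F1 vTop 0 isT; have F1v := F1 vV 0 isT.
have F1first := F1 vFirst 0 isT; have F1head := F1 vHead 0 isT.
rewrite /= E1 in F1one F1col F1cnt F1base F1top F1v F1first F1head.
apply: wp_seq; apply: wp_same.
  apply: (@mex_spec [seq m aCol w | w <- A v]); rewrite //= F1head //.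
move=> [m2 ii2 oo2 k2] [/= C1 C2 C3 K2] F2_.
have [/= F2 _] := F2_.
have F2one := F2 vOne 0 isT; have F2col := F2 aCol _ isT; have F2cnt := F2 aCnt _ isT.
have F2base := F2 vBase 0 isT; have F2top := F2 vTop 0 isT; have F2v := F2 vV 0 isT.
have F2first := F2 vFirst 0 isT; have F2head := F2 vHead 0 isT.
have F2tail := F2 vTail 0 isT; have F2queue := F2 aQueue _ isT; have F2seen := F2 aSeen _ isT.
have F2mark := F2 aMark _ isT.
rewrite /= in F2one F2col F2cnt F2base F2top F2v F2first F2head F2tail F2queue F2seen F2mark.
rewrite size_map in K2; rewrite F1base in C1 C3.
set c := m2 vC 0 in C1 C2 C3.
have Dcol x : m2 aCol x = m aCol x by rewrite F2col F1col.
have Dcnt x : m2 aCnt x = m aCnt x by rewrite F2cnt F1cnt.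
wp_steps; rewrite -/c F2v F1v Dcnt F2one F1one F2top F1top F2tail F2head F1head Q1t.
have qE : q ++ new = old ++ rcons D v ++ todo ++ new by rewrite /q -!catA cat_rcons.
have vU : v \notin old ++ D.
  by move: U; rewrite /q catA cat_uniq => /and3P[_ /norP[]].
have [vold vD] : v \notin old /\ v \notin D by apply/norP; rewrite -mem_cat.
have cpos : 0 < c by lia.
have c_max : m vTop 0 + (c - m vTop 0) = maxn (m vTop 0) c by lia.
have colD x : x \in old ++ D -> (if x == v then c else m aCol x) = m aCol x.
  by move=> Dx; case: eqP => // E; rewrite E (negbTE vU) in Dx.
have inD x : x \in D -> x \in old ++ D by rewrite mem_cat => ->; rewrite orbT.
have inO x : x \in old -> x \in old ++ D by rewrite mem_cat => ->.
exists new; split; last by lia.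
- split=> /=; rewrite ?F2base ?F1base ?F2first ?F1first ?c_max -?qE.
  + by split=> /= [|i lt_i|w]; rewrite ?F2tail ?F2queue ?Q1i ?F2seen ?Q1s.
  + by [].
  + by move=> x; rewrite mem_cat => /orP[/B //|/sub1]; apply: (adj_bound HA).
  + by [].
  + by rewrite -rcons_cat size_rcons F2head F1head Hd addn1.
  + by move=> a; rewrite F2mark F2head F1head M1.
  + move=> x; rewrite -rcons_cat mem_rcons inE negb_or => /andP[/negbTE-> nx].
    by rewrite Dcol Uc.
  + move=> a; rewrite -rcons_cat -cats1 count_cat /= eqxx addn0.
    have -> : count (fun x => (if x == v then c else m2 aCol x) == a) (old ++ D) =
              m aCnt a.
      by rewrite Cn; apply: eq_in_count => x Dx; rewrite Dcol colD.
    by rewrite Dcnt eq_sym; case: eqP => [->|]; rewrite ?addn0.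
  + exact: Ol.
  + move=> x y; rewrite mem_rcons inE => /orP[/eqP->|Dx] xy.
      (* A neighbor of [v] cannot be old, because finished components are closed under adjacency. *)
      have := sub2 y xy; rewrite qE mem_cat => /orP[oy|//].
      by case/negP: vold; apply: Ol oy _; rewrite (adj_sym HA).
    by rewrite catA cat_rcons mem_cat (Cl x y).
  + by move=> x ox; rewrite Dcol colD ?inO // Ole.
  + by lia.
  + move=> x; rewrite mem_rcons inE Dcol => /orP[/eqP->|Dx]; rewrite ?eqxx; first by lia.
    by rewrite colD ?inD //; have := Le x Dx; lia.
  + right; case: (leqP (m vTop 0) c) => le_c.
      by exists v; rewrite ?mem_rcons ?mem_head ?eqxx.
    case: Tp => [E|[x Dx Ex]]; first by lia.
    by exists x; rewrite ?mem_rcons ?inE ?Dx ?orbT // Dcol colD ?inD.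
  + have colN y : y \in D -> (if y == v then c else m2 aCol y) = m aCol y.
      by move=> Dy; rewrite Dcol colD ?inD.
    apply: greedy_rcons => /=; rewrite ?eqxx //.
    * by apply: greedy_ext G => y Dy; rewrite /= colN.
    * case: Pa => [[]|Pa]; first by left.
      by right; apply: Pa; rewrite mem_head.
    * move=> y Dy yv; rewrite colN // => E; case/negP: C2; rewrite -E.
      exact: map_f.
    (* The scan also marks 0, the color of uncolored vertices. A color above [vBase] is neither 0
       nor an old color, so its bearer lies in [D]. *)
    * move=> a lt_a; have /mapP[y yv Ey] := C3 a lt_a.
      have Dy : y \in D.
        have : y \in old ++ D.
          by case: (boolP (y \in _)) => // /Uc E0; lia.
        by rewrite mem_cat => /orP[/Ole|//]; lia.
      by exists y; split=> //; rewrite colN.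
  + right=> x; rewrite mem_cat => /orP[tx|nx].
      case: Pa => [[_ /= [/size0nil E0]]|Pa]; first by rewrite E0 in tx.
      have [|y Dy yx] := Pa x; first by rewrite inE tx orbT.
      by exists y; rewrite // mem_rcons inE Dy orbT.
    by exists v; rewrite ?mem_rcons ?mem_head // (adj_sym HA) sub1.
- by rewrite /= Hd [size (q ++ new)]size_cat size_q [size (todo ++ new)]size_cat; lia.
- by move=> x ox; rewrite /= Dcol colD ?inO.
Qed.

Lemma visits_spec n A old r s : adjacency n A ->
  cell s vOne 0 = 1 -> loaded_upto A n s -> cell s vT 0 = 1 ->
  searching n A old [::] [:: r] s ->
  wp (While vT visit) (fun s' => exists D, [/\ searching n A old D [::] s', r \in D,
    forall x, x \in old -> cell s' aCol x = cell s aCol x &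
    clk s' <= clk s + 18 * weight A D + 1]) s.
Proof.
move=> HA E1 HL ET H.
pose I s' := exists D todo, [/\ searching n A old D todo s', r \in D ++ todo,
  cell s' vT 0 = size todo, forall x, x \in old -> cell s' aCol x = cell s aCol x
  & clk s' <= clk s + 18 * weight A D].
(* Each visit advances [vHead], which is bounded by the length of a duplicate-free queue of vertices
   below [n]. *)
apply: (wp_while (I := I) (mu := fun s' => n - cell s' vHead 0)).
- by exists [::], [:: r]; split; rewrite ?mem_head //=; lia.
- move=> s1 [F _] [D [[|v todo] [H1 Hr HT Hc Hk]]] Hpos; first by rewrite HT in Hpos.
  have E1' : cell (tick s1) vOne 0 = 1.
    by have := F vOne 0 isT; rewrite E1; case: (s1).
  have HL' : loaded_upto A n (tick s1).
    have := F aDeg _ isT; have := F aStart _ isT; have := F aAdj _ isT.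
    case: (s1) => m ii oo k /= FA FS FD w lt_w.
    by rewrite /= FD FS; have [-> HL'] := HL w lt_w; split=> // j; rewrite FA; apply: HL'.
  (* The invariant does not mention the clock, so each field carries over by conversion. *)
  have H1' : searching n A old D (v :: todo) (tick s1).
    by case: (s1) H1 => m ii oo k; case; split.
  apply: wp_same; first exact: (visit_spec HA E1' HL' H1').
  move=> s2 [new [H2 T2 Hc2 K2]] _; split.
    exists (rcons D v), (todo ++ new); split=> //.
    - by rewrite catA cat_rcons mem_cat Hr.
    - by move=> x ox; rewrite Hc2 // -Hc //; case: (s1).
    by rewrite weight_rcons; rewrite clk_tick in K2; lia.
  have := searching_size H2; have := s_head H1; have := s_head H2.
  by rewrite -rcons_cat size_rcons !size_cat size_rcons; lia.
- move=> s1 _ [D [todo [H1 Hr HT Hc Hk]]] Hz.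
  have E0 : todo = [::] by apply: size0nil; lia.
  rewrite E0 cats0 in H1 Hr; exists D; split=> //; last by rewrite clk_tick; lia.
    by case: (s1) H1 => m ii oo k; case; split.
  by case: (s1) Hc.
Qed.

(** * Testing a component *)

(** [vBad] accumulates the truncated deficits of the inequality, so it stays 0 exactly when every
    vertex passes. *)
Definition check_vertex : cmd :=
  OLoad vV aQueue vFirst ;; OAdd vFirst vFirst vOne ;;
  OLoad vU aDeg vV ;; OLoad vC aCol vV ;; OLoad vC aCnt vC ;; OAdd vU vU vC ;;
  OSub vU vS vU ;; OAdd vBad vBad vU ;; OSub vT vTail vFirst.

Definition check : cmd :=
  OSub vS vTail vFirst ;; OSub vU vTop vBase ;; OConst vT 2 ;; OSub vU vU vT ;;
  When vU (OSub vT vTail vFirst ;; While vT check_vertex).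

Lemma check_spec n A old D s : adjacency n A ->
  cell s vOne 0 = 1 -> loaded_upto A n s ->
  searching n A old D [::] s ->
  wp check (fun s' => (cell s' vBad 0 == 0) =
      (cell s vBad 0 == 0) && ((cell s vTop 0 <= (cell s vBase 0).+2) ||
        all (fun x => size D <= size (A x) + cell s aCnt (cell s aCol x)) D) /\
    clk s' <= clk s + 10 * size D + 7) s.
Proof.
move=> HA; case: s => m ii oo k /= E1 HL H.
have [Qt Qi _] := s_queue H; rewrite /= cats0 in Qt Qi.
have Fi := s_first H; rewrite /= in Fi.
have B := s_bound H; rewrite cats0 in B.
rewrite /check; wp_steps; rewrite Qt Fi.
apply: wp_when => /= [Hu|Hu]; last first.
  by rewrite (_ : m vTop 0 <= _) ?andbT; [split; lia|lia].
rewrite (_ : m vTop 0 <= _ = false) /=; last by lia.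
wp_steps; rewrite Qt Fi.
have sD : size (old ++ D) - size old = size D by rewrite size_cat addKn.
rewrite sD.
pose ok x := size D <= size (A x) + m aCnt (m aCol x).
pose I s' := exists j, [/\ j <= size D, cell s' vFirst 0 = size old + j,
  cell s' vT 0 = size D - j,
  (cell s' vBad 0 == 0) = (m vBad 0 == 0) && all ok (take j D)
  & clk s' <= k + 6 + 10 * j].
apply: (wp_while (I := I) (mu := fun s' => cell s' vT 0)).
- by exists 0; rewrite take0 andbT subn0 addn0; split=> //=; lia.
- move=> [m1 ii1 oo1 k1] [F _] [j [le_j HF HT Hb Hk]] Hpos.
  have e1 := F vOne 0 isT; have eD := F aDeg _ isT; have eC := F aCol _ isT.
  have eN := F aCnt _ isT; have eS := F vS 0 isT; have eQ := F aQueue _ isT.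
  have eT := F vTail 0 isT.
  rewrite /= in e1 eD eC eN eS eQ eT HF HT Hb Hk Hpos.
  have lt_j : j < size D by lia.
  pose x := nth 0 D j.
  have Dx : x \in D by apply: mem_nth.
  have Ex : m1 aQueue (m1 vFirst 0) = x.
    rewrite eQ HF Qi ?size_cat ?ltn_add2l // nth_cat ltnNge leq_addr /=.
    by rewrite addKn.
  have dx : m aDeg x = size (A x).
    by case: (HL x) => //; apply: B; rewrite mem_cat Dx orbT.
  wp_steps; rewrite Ex eD eC eN eS eT e1 E1 Qt dx // HF size_cat; split; last by lia.
  exists j.+1; split=> //=; try lia.
  rewrite (take_nth 0 lt_j) all_rcons addn_eq0 Hb subn_eq0 -/x /ok.
  by rewrite -andbA [all _ _ && _]andbC.
- move=> [m1 ii1 oo1 k1] [F _] [j [/= le_j HF HT Hb Hk]] Hz.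
  have Ej : j = size D by lia.
  by rewrite Ej take_size in Hb Hk; split=> //; lia.
Qed.

(** Adding a zero acts as a copy: moving [vFirst] to [vTail] and [vBase] to [vTop] turns the current
    component into a finished one. *)
Definition component : cmd :=
  OSave aSeen vR vOne ;; OSave aQueue vTail vR ;; OAdd vTail vTail vOne ;;
  OSub vT vTail vHead ;; While vT visit ;; check ;;
  OConst vU 0 ;; OAdd vFirst vTail vU ;; OAdd vBase vTop vU.

(** A nonzero [bad] refutes every coloring of the whole graph, not only the greedy one, so it
    remains justified when further components are added. *)
Definition verdict (A : nat -> seq nat) (old : seq nat) (col : nat -> nat)
    (bad : nat) : Prop :=
  if bad == 0 then
    forall x y, x \in old -> y \in A x -> col y <> col x /\
      forall z, z \in A y -> z \in A x \/ col z = col x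
  else forall c, ~ locally_perfect_nat A c.

Lemma eq_verdict A old col col' bad : col =1 col' ->
  verdict A old col bad -> verdict A old col' bad.
Proof.
rewrite /verdict => E; case: eqP => // _ V x y ox xy; rewrite -!E.
by have [N V'] := V x y ox xy; split=> // z; rewrite -E; apply: V'.
Qed.

Lemma loaded_same A n s s' :
  (forall a i, a \in [:: aDeg; aStart; aAdj] -> cell s' a i = cell s a i) ->
  loaded_upto A n s -> loaded_upto A n s'.
Proof.
move=> F HL v lt_v; rewrite !F //; have [-> HL'] := HL v lt_v.
by split=> // j; rewrite F //; apply: HL'.
Qed.

Lemma searching_verdict n A old D s col bad bad' : adjacency n A ->
  searching n A old D [::] s -> verdict A old col bad ->
  (forall x, x \in old -> cell s aCol x = col x) ->
  (bad' == 0) =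
    (bad == 0) && ((cell s vTop 0 <= (cell s vBase 0).+2) ||
      all (fun x => size D <= size (A x) + cell s aCnt (cell s aCol x)) D) ->
  verdict A (old ++ D) (cell s aCol) bad'.
Proof.
move=> HA H V Ec Eb; rewrite /verdict Eb; move: V; rewrite /verdict.
have G := s_greedy H; have Ol := s_old H.
have Cl u v : u \in D -> v \in A u -> v \in D.
  by move=> Du uv; have := s_closed H Du uv; rewrite cats0.
(* Old colors are at most [vBase] and those of [D] lie above it, so the global counters give the
   class sizes within [D]. *)
have cnt x : x \in D -> cell s aCnt (cell s aCol x) =
    count (fun y => cell s aCol y == cell s aCol x) D.
  move=> Dx; rewrite (s_count H) count_cat.
  rewrite (@eq_in_count _ _ pred0) ?count_pred0 // => y oy.
  by have := s_old_le H oy; have := greedy_gt G Dx; case: eqP => // ->; lia.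
case: eqP => [_ V|_ V] //; case: ifP => /= [ok|nok].
  move=> x y; rewrite mem_cat => /orP[ox|Dx] xy.
    have oy := Ol _ _ ox xy; have [N V2] := V x y ox xy; rewrite !Ec //; split=> // z yz.
    by rewrite Ec ?(Ol _ _ oy yz) //; apply: V2.
  split; first exact: (greedy_proper HA G Dx (Cl _ _ Dx xy) xy).
  move=> z; apply: (greedy_sound HA G Cl _ Dx xy).
  case/orP: ok => [le2|/allP ok]; [left|right] => u Du.
    exact: leq_trans (s_le_top H Du) le2.
  by rewrite -cnt //; apply: ok.
move=> c Hc; case/norP: nok => Nle /negP; apply; apply/allP => x Dx; rewrite cnt //.
(* As [vTop] exceeds [vBase] by more than two, it is attained in [D], which supplies the third color
   for [greedy_complete]. *)
case: (s_top H) => [E|[t Dt Et]]; first by rewrite E in Nle; lia.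
by apply: (greedy_complete HA Hc G Cl Dt _ Dx); rewrite Et ltnNge.
Qed.

Lemma size_weight A q : size q <= weight A q.
Proof. by elim: q => //= x q IH; rewrite /weight /= -/(weight A q); lia. Qed.

Lemma component_spec n A (old : seq nat) r s : adjacency n A ->
  cell s vOne 0 = 1 -> loaded_upto A n s -> cell s vR 0 = r -> r < n ->
  r \notin old -> searching n A old [::] [::] s ->
  verdict A old (cell s aCol) (cell s vBad 0) ->
  wp component (fun s' => exists D, [/\ searching n A (old ++ D) [::] [::] s', r \in D,
    verdict A (old ++ D) (cell s' aCol) (cell s' vBad 0) &
    clk s' <= clk s + 43 * weight A D]) s.
Proof.
move=> HA; case: s => m ii oo k /= E1 HL ER lt_r Nr H V.
have [Qt Qi Qs] := s_queue H; have Hd := s_head H.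
rewrite /= cats0 in Qt Qi Qs; rewrite /= cats0 in Hd.
rewrite /component; wp_steps; rewrite ER E1 Qt Hd.
apply: wp_same.
  apply: (@visits_spec n A old r) => //=.
  - by lia.
  have Sz : size (old ++ [:: r]) = size old + 1 by rewrite size_cat.
  case: H => /= _ U B Fi _ Mk Uc Cn Ol Cl Ole Bt Le Tp G Pa; rewrite !cats0 in U B Uc.
  split=> //=.
  + split=> //= [i|w].
      rewrite Sz addn1 ltnS leq_eqVlt nth_cat => /orP[/eqP->|lt_i].
        by rewrite eqxx ltnn subnn.
      by rewrite lt_i ltn_eqF ?Qi.
    by rewrite mem_cat inE; case: eqP => [->|_]; rewrite ?orbT ?orbF ?Qs.
  + by rewrite cat_uniq U /= orbF Nr.
  + by move=> x; rewrite mem_cat inE => /orP[/B //|/eqP->].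
  + by rewrite cats0.
  + by move=> x; rewrite cats0; apply: Uc.
  + by left.
move=> s1 [D [H1 Dr Hc K1]] F1_; have [F1 _] := F1_.
have E1' := F1 vOne 0 isT; rewrite /= E1 in E1'.
have HL1 : loaded_upto A n s1.
  apply: loaded_same HL => a i Ha; rewrite F1 /=.
    by move: Ha; rewrite !inE => /or3P[]/eqP->.
  by move: Ha; rewrite !inE => /or3P[]/eqP->.
apply: wp_seq; apply: wp_same; first exact: (check_spec HA E1' HL1 H1).
case: s1 H1 Hc K1 F1 {F1_ E1' HL1} => m1 ii1 oo1 k1 H1 Hc K1 F1.
move=> [m2 ii2 oo2 k2] [Hb K2] [/= F2 _].
have bad1 := F1 vBad 0 isT; rewrite /= in bad1 Hb K1 K2 Hc.
have e a : a \in [:: vTail; vHead; vBase; vTop; aQueue; aSeen; aMark; aCol; aCnt] ->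
  m2 a =1 m1 a.
  by move=> Ha i; apply: F2; move: Ha; rewrite !inE; do 8![case/orP=> [/eqP->//|]] => /eqP->.
have V1 : verdict A (old ++ D) (m1 aCol) (m2 vBad 0).
  by rewrite -bad1 in V; apply: (searching_verdict HA H1 V).
(* The total is 18 times the weight, plus 10 times the size, plus 15. A nonempty component weighs at
   least 1 and at least its size, whence 43 = 18 + 10 + 15. *)
have Dpos : 0 < size D by case: (D) Dr.
have := size_weight A D => szD.
wp_steps; exists D; split=> //=; last by lia.
  case: H1 => /= -[Q1t Q1i Q1s] U B Fi H1d Mk Uc Cn Ol Cl Ole Bt Le Tp G Pa.
  rewrite /= !cats0 in Q1t Q1i Q1s U B Cl.
  split=> //=; rewrite ?cats0 ?addn0 //.
  - by split=> /= [|i lt_i|x]; rewrite e ?Q1t ?Q1i ?Q1s.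
  - by rewrite e.
  - by rewrite e.
  - by move=> a; rewrite !e.
  - by move=> x nx; rewrite e ?Uc.
  - by move=> a; rewrite e // Cn; apply: eq_count => x; rewrite e.
  - move=> x y; rewrite !mem_cat => /orP[ox|Dx] xy; first by rewrite (Ol x y).
    by rewrite (Cl x y) ?orbT.
  - move=> x; rewrite !e // mem_cat => /orP[/Ole le|/Le //].
    exact: leq_trans le Bt.
  - by left.
  - exact: greedy_nil.
  - by right.
by apply: eq_verdict V1 => x; rewrite /= e.
Qed.

(** * Search over all components and output *)

Definition search : cmd :=
  OConst vR 0 ;; OSub vT vN vR ;;
  While vT (
    OLoad vU aSeen vR ;; OSub vU vOne vU ;; When vU component ;;
    OAdd vR vR vOne ;; OSub vT vN vR).

Lemma search_spec n A s : adjacency n A ->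
  cell s vN 0 = n -> cell s vOne 0 = 1 -> loaded_upto A n s ->
  searching n A [::] [::] [::] s -> cell s vBad 0 = 0 ->
  wp search (fun s' =>
    verdict A (iota 0 n) (cell s' aCol) (cell s' vBad 0) /\
    clk s' <= clk s + 6 * n + 43 * weight A (iota 0 n) + 3) s.
Proof.
move=> HA; case: s => m ii oo k /= EN E1 HL H Hbad.
rewrite /search; wp_steps.
pose I s' := exists i old, [/\ i <= n, searching n A old [::] [::] s',
  cell s' vR 0 = i, cell s' vT 0 = n - i &
  [/\ {subset iota 0 i <= old}, verdict A old (cell s' aCol) (cell s' vBad 0)
    & clk s' <= k + 2 + 6 * i + 43 * weight A old]].
apply: (wp_while (I := I) (mu := fun s' => cell s' vT 0)).
- exists 0, [::]; split=> //=; try by rewrite ?EN.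
    by case: H => *; split.
  by split=> //=; [rewrite /verdict /= Hbad|lia].
- move=> [m1 ii1 oo1 k1] [F _] [i [old [le_i H1 HR HT [sub V Hk]]]] Hpos.
  have e0 := F vN 0 isT; have e1 := F vOne 0 isT.
  rewrite /= EN E1 in e0 e1 HR HT V Hk Hpos.
  have HL1 : loaded_upto A n (State m1 ii1 oo1 k1).
    apply: loaded_same HL => a j Ha; rewrite F /=.
      by move: Ha; rewrite !inE => /or3P[]/eqP->.
    by move: Ha; rewrite !inE => /or3P[]/eqP->.
  have lt_i : i < n by lia.
  have [Qt Qi Qs] := s_queue H1; rewrite /= cats0 in Qt Qi Qs.
  wp_steps; rewrite HR Qs e1; apply: wp_same.
    apply: (wp_when (Q := fun s' => exists old', [/\ searching n A old' [::] [::] s',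
      {subset i :: old <= old'}, verdict A old' (cell s' aCol) (cell s' vBad 0)
      & clk s' <= k1 + 4 + 43 * weight A old' - 43 * weight A old])) => /= Hi.
      have Ni : i \notin old by apply/negP => E; rewrite E in Hi.
      apply: wp_same.
        apply: (@component_spec n A old i) => //=.
        by case: H1 => *; split.
      move=> s2 [D [H2 Di V2 K2]] _; exists (old ++ D); split=> //.
        by move=> x; rewrite inE mem_cat => /orP[/eqP->|->]; rewrite ?Di ?orbT.
      by rewrite weight_cat; rewrite /= in K2; lia.
    have oi : i \in old by case: (_ \in _) Hi.
    exists old; split=> //; [by case: H1 => *; split| |lia].
    by move=> x; rewrite inE => /orP[/eqP->|].
  move=> [m2 ii2 oo2 k2] [old' [H2 sub' V2 K2]] [/= F2 _].
  have M20 := F2 vN 0 isT; have M21 := F2 vOne 0 isT; have M2R := F2 vR 0 isT.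
  rewrite /= in M20 M21 M2R V2 K2.
  wp_steps; rewrite M20 M21 M2R e0 e1 HR; split; last by lia.
  exists i.+1, old'; split=> //=; try lia; first by case: H2 => *; split.
  split=> //=; last by lia.
  move=> x; rewrite -[_ :: _]/(iota 0 i.+1) mem_iota => /= lt_x.
  apply: sub'; rewrite inE; case: eqVneq => //= N.
  by apply: sub; rewrite mem_iota; lia.
- move=> [m1 ii1 oo1 k1] [F _] [i [old [le_i H1 /= HR HT [sub V Hk]]]] Hz.
  have Ei : i = n by lia.
  (* Every vertex has been tried as a root, so each belongs to exactly one finished component. *)
  have Ep : perm_eq old (iota 0 n).
    have := s_uniq H1; have := s_bound H1; rewrite /= !cats0 => B U.
    apply: uniq_perm; rewrite ?iota_uniq // => x; apply/idP/idP => [/B|].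
      by rewrite mem_iota.
    by rewrite -Ei => /sub.
  split.
    move: V; rewrite /verdict; case: eqP => // _ V x y.
    by rewrite -(perm_mem Ep); apply: V.
  have -> : weight A (iota 0 n) = weight A old.
    by rewrite /weight !sumnE !big_map; apply: perm_big; rewrite perm_sym.
  by rewrite -Ei; lia.
Qed.

(** In the absence of an alternative branch, the truncated [1 - vBad] serves as the negated test. *)
Definition answer : cmd :=
  When vBad (OConst vT 0 ;; OPrint vT) ;; OSub vU vOne vBad ;;
  When vU (
    OPrint vOne ;; OConst vR 0 ;; OSub vT vN vR ;;
    While vT (OLoad vC aCol vR ;; OPrint vC ;; OAdd vR vR vOne ;; OSub vT vN vR)).

Lemma answer_spec n s : cell s vN 0 = n -> cell s vOne 0 = 1 -> out s = [::] ->
  wp answer (fun s' =>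
    out s' = (if cell s vBad 0 == 0 then 1 :: mkseq (cell s aCol) n else [:: 0]) /\
    clk s' <= clk s + 5 * n + 9) s.
Proof.
case: s => m ii oo k /= EN E1 ->.
rewrite /answer; apply: wp_seq; apply: wp_when => /= Hb.
  wp_steps; apply: wp_when => /=; rewrite E1 gtn_eqF //; first by lia.
  by move=> _; split=> //; lia.
wp_steps; apply: wp_when => /=; rewrite E1 Hb //= => _.
wp_steps; rewrite EN E1.
pose I s' := exists i, [/\ i <= n, cell s' vR 0 = i, cell s' vT 0 = n - i,
  out s' = 1 :: mkseq (m aCol) i & clk s' <= k + 6 + 5 * i].
apply: (wp_while (I := I) (mu := fun s' => cell s' vT 0)).
- by exists 0; split=> //=; lia.
- move=> [m1 ii1 oo1 k1] [F _] [i [le_i HR HT Ho Hk]] Hpos.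
  have e0 := F vN 0 isT; have e1 := F vOne 0 isT; have eC := F aCol _ isT.
  rewrite /= EN E1 in e0 e1 eC HR HT Ho Hk Hpos.
  wp_steps; rewrite HR e0 e1 eC Ho; split; last by lia.
  by exists i.+1; split; rewrite ?mkseqS //=; lia.
- move=> [m1 ii1 oo1 k1] [F _] [i [le_i /= HR HT Ho Hk]] Hz.
  have Ei : i = n by lia.
  by rewrite Ho Ei; split=> //; lia.
Qed.

Definition perfect_coloring_cmd : cmd := load ;; search ;; answer.

Lemma perfect_coloring_cmd_spec n A : adjacency n A ->
  wp perfect_coloring_cmd (fun s => (exists col bad, verdict A (iota 0 n) col bad /\
      out s = if bad == 0 then 1 :: mkseq col n else [:: 0]) /\
    clk s <= 11 * n + 50 * weight A (iota 0 n) + 16)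
    (start_state (n :: flatten [seq size (A v) :: A v | v <- iota 0 n])).
Proof.
move=> HA; rewrite -[flatten _]cats0 /perfect_coloring_cmd.
apply: wp_seq; apply: wp_same; first exact: (load_spec A n [::]).
move=> s1 [N1 One1 L1 K1] [F1 O1]; have out1 := O1 isT.
have H1 : searching n A [::] [::] [::] s1.
  (* Loading writes none of the variables of the search, so they keep their initial value 0. *)
  have zero a i : a \notin writes load -> cell s1 a i = 0 by exact: F1.
  split=> //=; rewrite ?zero //.
  - by split=> //= [|w]; rewrite zero.
  - by move=> a; rewrite zero.
  - by move=> x _; rewrite zero.
  - by move=> a; rewrite zero.
  - by left.
  - exact: greedy_nil.
  - by right.
apply: wp_seq; apply: wp_same.
  by apply: (search_spec HA N1 One1 L1 H1); rewrite F1.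
move=> s2 [V2 K2] [F2 O2]; apply: wp_same.
  apply: (@answer_spec n).
  - by rewrite (F2 vN 0 isT).
  - by rewrite (F2 vOne 0 isT).
  - by rewrite (O2 isT) out1.
move=> s3 [out3 K3] _; split; last by lia.
by exists (cell s2 aCol), (cell s2 vBad 0).
Qed.

(** * Graphs on ordinals *)

Definition adj_nat (n : nat) (adj : 'I_n -> seq 'I_n) (x : nat) : seq nat :=
  if insub x is Some v then [seq val w | w <- adj v] else [::].

Lemma adj_natE n (adj : 'I_n -> seq 'I_n) (v : 'I_n) :
  adj_nat adj v = [seq val w | w <- adj v].
Proof. by rewrite /adj_nat valK. Qed.

Lemma mem_adj_nat n e (adj : 'I_n -> seq 'I_n) (v w : 'I_n) :
  adjacency_lists e adj -> (val w \in adj_nat adj v) = e v w.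
Proof. by move=> H; rewrite adj_natE (mem_map val_inj); case: (H v) => _ ->. Qed.

Lemma adj_natP n e (adj : 'I_n -> seq 'I_n) x y : adjacency_lists e adj ->
  y \in adj_nat adj x -> exists v w : 'I_n, [/\ x = v, y = w & e v w].
Proof.
move=> H; rewrite {1}/adj_nat; case: insubP => [v _ <-|//] /mapP[w vw ->].
by exists v, w; split=> //; case: (H v) => _ <-.
Qed.

Lemma adj_nat_adjacency n e (adj : 'I_n -> seq 'I_n) :
  simple_graph e -> adjacency_lists e adj -> adjacency n (adj_nat adj).
Proof.
move=> [sym_e irr_e] H; split.
- move=> x; rewrite /adj_nat; case: insub => // v.
  by rewrite (map_inj_uniq val_inj); case: (H v).
- move=> x y; apply/idP/idP => /(adj_natP H)[v [w [-> -> vw]]];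
    by rewrite (mem_adj_nat _ _ H) sym_e.
- move=> x; apply/negP=> /(adj_natP H)[v [w [-> /val_inj <-]]].
  by rewrite irr_e.
- by move=> x y /(adj_natP H)[v [w [_ -> _]]].
Qed.

Lemma encode_graph_nat n (adj : 'I_n -> seq 'I_n) :
  encode_graph adj =
  n :: flatten [seq size (adj_nat adj v) :: adj_nat adj v | v <- iota 0 n].
Proof.
rewrite /encode_graph -val_enum_ord -map_comp; congr (_ :: flatten _).
by apply: eq_map => v /=; rewrite adj_natE size_map.
Qed.

(** The degree sum counts ordered pairs of adjacent vertices, and such a pair is determined by its
    edge together with the order of its two ends. *)
Lemma sum_degrees n e (adj : 'I_n -> seq 'I_n) :
  simple_graph e -> adjacency_lists e adj ->
  \sum_(v < n) size (adj v) <= 2 * #|edges e|.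
Proof.
move=> [sym_e irr_e] H.
have -> : \sum_(v < n) size (adj v) = #|[pred p : 'I_n * 'I_n | e p.1 p.2]|.
  transitivity (\sum_(v < n) \sum_(w < n | e v w) 1); last first.
    by rewrite pair_big_dep /= sum1_card.
  apply: eq_bigr => v _; rewrite sum1_card -(card_uniqP (proj1 (H v))).
  by apply: eq_card => w; rewrite (proj2 (H v)).
pose f (p : 'I_n * 'I_n) := ([set p.1; p.2], p.1 < p.2).
have f_inj : {in [pred p : 'I_n * 'I_n | e p.1 p.2] &, injective f}.
  have neq v w : e v w -> v != w by apply: contraTneq => ->; rewrite irr_e.
  move=> [v w] [v' w']; rewrite !inE /= => /neq nvw /neq nvw' [/setP E lt_eq].
  have : (v == v') || (v == w') by have := E v; rewrite !inE eqxx.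
  have : (w == v') || (w == w') by have := E w; rewrite !inE eqxx orbT.
  case/orP=> /eqP Ew /orP[]/eqP Ev; rewrite Ev Ew ?eqxx // in nvw lt_eq *.
  by case/negP: nvw; apply/eqP/val_inj => /=; lia.
rewrite -(card_in_image f_inj) mulnC -card_bool -cardsT -cardsX.
apply/subset_leq_card/subsetP=> _ /imageP[p ep ->].
rewrite in_setX in_setT andbT; apply/imsetP; exists p => //.
by rewrite inE.
Qed.

Lemma weight_adj_nat n e (adj : 'I_n -> seq 'I_n) :
  simple_graph e -> adjacency_lists e adj ->
  weight (adj_nat adj) (iota 0 n) <= n + 2 * #|edges e|.
Proof.
move=> He H; rewrite /weight sumnE big_map -{1}(subn0 n) -/(index_iota 0 n) big_mkord.
under eq_bigr => v _ do rewrite adj_natE size_map -addn1.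
rewrite big_split /= sum1_card card_ord addnC leq_add2l.
exact: sum_degrees.
Qed.

(** The value 0 off the vertices is arbitrary: only numbers below [n] have or are neighbors in
    [adj_nat]. *)
Lemma perfect_locally_nat n e (adj : 'I_n -> seq 'I_n) (col : 'I_n -> nat) :
  simple_graph e -> adjacency_lists e adj -> perfect_coloring e col ->
  locally_perfect_nat (adj_nat adj) (fun x => if insub x is Some v then col v else 0).
Proof.
move=> He H /(perfect_coloringP _ He)[prop loc]; split.
  by move=> x y /(adj_natP H)[v [w [-> -> vw]]]; rewrite !valK => /esym; apply: prop.
move=> x y z /(adj_natP H)[v [w [-> -> vw]]] /(adj_natP H)[w' [u [/val_inj <- -> wu]]].
rewrite !valK (mem_adj_nat _ _ H); have [|->] := loc v w u vw wu; by [left|right].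
Qed.

Lemma verdict_perfect n e (adj : 'I_n -> seq 'I_n) (col : nat -> nat) :
  simple_graph e -> adjacency_lists e adj -> verdict (adj_nat adj) (iota 0 n) col 0 ->
  perfect_coloring e (fun v => col (val v)).
Proof.
move=> He H V; apply/(perfect_coloringP _ He).
have in_iota (v : 'I_n) : val v \in iota 0 n by rewrite mem_iota /= ltn_ord.
split=> [v w vw|v w u vw wu].
  have vw' : val w \in adj_nat adj v by rewrite (mem_adj_nat _ _ H).
  by have [/nesym] := V _ _ (in_iota v) vw'.
have vw' : val w \in adj_nat adj v by rewrite (mem_adj_nat _ _ H).
have wu' : val u \in adj_nat adj w by rewrite (mem_adj_nat _ _ H).
have [_ /(_ _ wu')] := V _ _ (in_iota v) vw'.
by rewrite (mem_adj_nat _ _ H) => -[|->]; [left|right].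
Qed.

Theorem mainTheorem2 :
  exists (p : program) (C : nat),
    forall (n : nat) (e : rel 'I_n) (adj : 'I_n -> seq 'I_n),
      simple_graph e -> adjacency_lists e adj ->
      exists2 out : seq nat,
        halts_within p (encode_graph adj) (C * (n + #|edges e| + 1)) out &
        correct_answer e out.
Proof.
(* With m edges the clock is at most 11 n + 50 (n + 2 m) + 16, hence at most 100 (n + m + 1), and a
   tick pays for eight machine steps. *)
exists (compile 0 perfect_coloring_cmd), 800 => n e adj He Hadj.
have HA := adj_nat_adjacency He Hadj.
have [s R [[col [bad [V out_s]]] clk_s]] := perfect_coloring_cmd_spec HA.
exists (out s).
  have [||t le_t Ht] := @compile_halts perfect_coloring_cmd (encode_graph adj)
    (out s) (clk s).
  - by [].
  - by rewrite encode_graph_nat; exists s.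
  exists t => //; apply: leq_trans le_t _.
  by have := weight_adj_nat He Hadj; lia.
have encodeE : encode_coloring (fun v : 'I_n => col (val v)) = 1 :: mkseq col n.
  by rewrite /encode_coloring /mkseq -val_enum_ord -map_comp.
rewrite out_s; move: V; case: (eqVneq bad 0) => [->|/negbTE nb] V; split=> Hp.
- exists (fun v : 'I_n => col (val v)); first exact: verdict_perfect V.
  by rewrite encodeE.
- by case: Hp; eexists; apply: verdict_perfect V.
- case: Hp => c /(perfect_locally_nat He Hadj).
  by move: V; rewrite /verdict nb => V /V.
- by [].
Qed.
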